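(* Let $\mathbb{G}$ be a homogeneous group with homogeneous dimension $Q$ equipped with a quasi-norm $|\cdot|$. Let $0<p\le q<\infty$, let $a,b\in\mathbb{R}$ and $\epsilon>0$. Then the inequality $$\left(\int_{\mathbb{G}}\left[\exp\left(\epsilon\,|\mathbb{B}(0,|x|)|^{\epsilon}\int_{\mathbb{G}\setminus\mathbb{B}(0,|x|)}|\mathbb{B}(0,|y|)|^{-\epsilon-1}\log f(y)\,dy\right)\right]^q|\mathbb{B}(0,|x|)|^a\,dx\right)^{\frac1q}\le C\left(\int_{\mathbb{G}}f^p(x)\,|\mathbb{B}(0,|x|)|^b\,dx\right)^{\frac1p}$$ holds for all positive functions $f$ on $\mathbb{G}$ with some finite constant $C$ (independent of $f$) if and only if $$p(a+1)-q(b+1)=0.$$ Moreover, the least possible constant $C$ such that the inequality holds satisfies $$\left(\frac pq\right)^{\frac1q}\epsilon^{\frac1p-\frac1q}\exp\left(-\frac{b+1}{\epsilon p}-\frac1p\right)\le C\le\left(\frac pq\right)^{\frac1q}\epsilon^{\frac1p-\frac1q}\exp\left(-\frac{b+1}{\epsilon p}\right).$$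
   Context: A homogeneous group $\mathbb{G}$ is a Lie group identified with $(\mathbb{R}^N,\circ)$ equipped with dilations $D_\lambda(x)=(\lambda^{v_1}x_1,\dots,\lambda^{v_N}x_N)$, $v_1,\dots,v_N>0$, which are automorphisms of the group for every $\lambda>0$; one writes $\lambda x$ for $D_\lambda(x)$. Its homogeneous dimension is $Q=v_1+\dots+v_N$. The Haar measure $dx$ is Lebesgue measure on $\mathbb{R}^N$, and $|\omega|$ denotes the Haar measure of a measurable set $\omega\subset\mathbb{G}$. A quasi-norm is a continuous function $|\cdot|:\mathbb{G}\to[0,\infty)$ with $|x^{-1}|=|x|$ for all $x$, $|\lambda x|=\lambda|x|$ for all $x$ and $\lambda>0$, and $|x|=0$ if and only if $x=0$. $\mathbb{B}(0,r)$ is the quasi-ball $\{y\in\mathbb{G}:|y|<r\}$. With $\mathfrak{S}=\{x\in\mathbb{G}:|x|=1\}$ and $\sigma$ the unique Radon measure on $\mathfrak{S}$ such that $\int_{\mathbb{G}}f(x)\,dx=\int_0^\infty\int_{\mathfrak{S}}f(ry)\,r^{Q-1}\,d\sigma(y)\,dr$ for all $f\in L^1(\mathbb{G})$, one has $|\mathbb{B}(0,|x|)|=|x|^Q|\mathfrak{S}|/Q$, where $|\mathfrak{S}|=\sigma(\mathfrak{S})$. *)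

(* Defs.v *)
From HB Require Import structures.
From mathcomp Require Import all_boot all_order all_algebra.
From mathcomp Require Import all_classical all_reals all_analysis.

Set Implicit Arguments.
Unset Strict Implicit.
Unset Printing Implicit Defensive.

Import Order.TTheory GRing.Theory Num.Theory.
Import numFieldNormedType.Exports.

Local Open Scope classical_set_scope.
Local Open Scope ring_scope.

(* 'rV[R]_n with the sigma-algebra generated by the coordinates, i.e. the Borel
   sigma-algebra of R^n. *)
Definition rV_borel (R : realType) (n : nat) : Type := 'rV[R]_n.

Section rV_borel_measurable.
Context (R : realType) (n : nat).

Definition rV_coord (i : 'I_n) (v : rV_borel R n) : measurableTypeR R :=
  (v : 'rV[R]_n) ord0 i.

Let rV0 : g_sigma_preimage rV_coord set0.
Proof. exact: sigma_algebra0. Qed.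

Let rVC A : g_sigma_preimage rV_coord A -> g_sigma_preimage rV_coord (~` A).
Proof. exact: sigma_algebraC. Qed.

Let rVU (F : (set (rV_borel R n))^nat) :
  (forall i, g_sigma_preimage rV_coord (F i)) ->
  g_sigma_preimage rV_coord (\bigcup_i (F i)).
Proof. exact: sigma_algebra_bigcup. Qed.

HB.instance Definition _ := Pointed.copy (rV_borel R n) 'rV[R]_n.
HB.instance Definition _ :=
  @isMeasurable.Build default_measure_display (rV_borel R n)
    (g_sigma_preimage rV_coord) rV0 rVC rVU.

End rV_borel_measurable.

Section rV_cons.
Context (R : realType) (n : nat).

Definition rV_cons (z : measurableTypeR R * rV_borel R n) : rV_borel R n.+1 :=
  row_mx (z.1 : R)%:M (z.2 : 'rV[R]_n) : 'rV[R]_(1 + n).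

Definition rV_uncons (v : rV_borel R n.+1) : measurableTypeR R * rV_borel R n :=
  (rV_coord ord0 v, rsubmx (v : 'rV[R]_(1 + n))).

Lemma rV_consK : cancel rV_cons rV_uncons.
Proof.
move=> [x v]; rewrite /rV_uncons /rV_cons /rV_coord /= (@row_mxKr R 1 1 n).
congr pair; rewrite (_ : ord0 = lshift n ord0 :> 'I_(1 + n)); last exact/val_inj.
by rewrite [LHS](@row_mxEl R 1 1 n) mxE eqxx mulr1n.
Qed.

Lemma rV_unconsK : cancel rV_uncons rV_cons.
Proof.
move=> v; rewrite -[RHS](@hsubmxK R 1 1 n v).
rewrite (_ : lsubmx _ = (rV_coord ord0 v : R)%:M)//.
apply/rowP => i; rewrite !mxE !ord1 eqxx mulr1n /rV_coord.
by rewrite (_ : lshift n ord0 = ord0 :> 'I_(1 + n))//; exact/val_inj.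
Qed.

Lemma measurable_rV_coord m (i : 'I_m) :
  measurable_fun [set: rV_borel R m] (@rV_coord R m i).
Proof.
move=> _ Y mY; rewrite setTI; apply: sub_sigma_algebra => /=.
rewrite -bigcup_seq/=; exists i => /=; first by rewrite mem_index_enum.
by exists Y => //; rewrite setTI.
Qed.

Lemma measurable_fun_rVP d (T : measurableType d) m (f : T -> rV_borel R m) :
  measurable_fun [set: T] f <->
  forall i, measurable_fun [set: T] (@rV_coord R m i \o f).
Proof.
split=> [mf i|mf]; first by apply: measurableT_comp mf; exact: measurable_rV_coord.
have fS : g_sigma_preimage (fun i => @rV_coord R m i \o f) `<=` measurable.
  apply: smallest_sub; first exact: sigma_algebra_measurable.
  by move=> A; rewrite -bigcup_seq => -[i _ [B mB <-]]; exact: mf.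
move=> _ A mA; apply: fS; rewrite (@g_sigma_preimage_comp _ _ _ (rV_borel R m)).
by exists A.
Qed.

Lemma measurable_rV_cons : measurable_fun setT rV_cons.
Proof.
apply/measurable_fun_rVP => i.
case: (splitP (i : 'I_(1 + n))) => j ij.
- rewrite (_ : _ \o _ = fst)//; apply/funext => z /=; rewrite /rV_cons /rV_coord.
  rewrite (_ : i = lshift n j :> 'I_(1 + n)); last exact/val_inj.
  by rewrite [LHS](@row_mxEl R 1 1 n) mxE (ord1 j) eqxx mulr1n.
- rewrite (_ : _ \o _ = @rV_coord R n j \o snd).
    by apply: measurableT_comp => //; exact: measurable_rV_coord.
  apply/funext => z /=; rewrite /rV_cons /rV_coord.
  rewrite (_ : i = rshift 1 j :> 'I_(1 + n)); last exact/val_inj.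
  by rewrite [LHS](@row_mxEr R 1 1 n).
Qed.

Lemma measurable_rV_uncons : measurable_fun setT rV_uncons.
Proof.
apply: measurable_fun_pair; first exact: measurable_rV_coord.
apply/measurable_fun_rVP => i.
rewrite (_ : _ \o _ = rV_coord (rshift 1 i : 'I_n.+1)).
  exact: measurable_rV_coord.
by apply/funext => v; rewrite /rV_coord /= mxE.
Qed.

End rV_cons.

Section lebesgue_rV_borel.
Context (R : realType).
Local Open Scope ereal_scope.

(* Lebesgue measure on the Borel sets of R^n, by slicing along the first
   coordinate. *)
Fixpoint lebesgue_rV_borel (n : nat) : set (rV_borel R n) -> \bar R :=
  match n with
  | 0 => @dirac _ (rV_borel R 0) (0%R : 'rV[R]_0) R
  | m.+1 => fun A => \int[lebesgue_measure]_x
      lebesgue_rV_borel [set v : rV_borel R m | A (rV_cons (x, v))]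
  end.

Let pushcons n (m : {sigma_finite_measure set (rV_borel R n) -> \bar R}) :
    set (rV_borel R n.+1) -> \bar R :=
  pushforward (@lebesgue_measure R \x m) (@rV_cons R n).

Let pushcons_measure n (m : {sigma_finite_measure set (rV_borel R n) -> \bar R}) :
    {measure set (rV_borel R n.+1) -> \bar R} :=
  measure_function_pushforward__canonical__measure_function_Measure
    (@lebesgue_measure R \x m) (@measurable_rV_cons R n).

Let pushcons_sigma_finite n (m : {sigma_finite_measure set (rV_borel R n) -> \bar R}) :
  sigma_finite setT (pushcons m).
Proof.
have /sigma_finiteP[F [TF ndF Foo]] := sigma_finiteT (@lebesgue_measure R).
have /sigma_finiteP[G [TG ndG Goo]] := sigma_finiteT m.
exists (fun k => @rV_uncons R n @^-1` (F k `*` G k)).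
  apply/seteqP; split => // v _.
  have [[k _ Fk] [l _ Gl]] :
      (\bigcup_k F k) (rV_uncons v).1 /\ (\bigcup_k G k) (rV_uncons v).2.
    by rewrite -TF -TG.
  exists (maxn k l) => //; split.
    by move: Fk; exact/subsetPset/ndF/leq_maxl.
  by move: Gl; exact/subsetPset/ndG/leq_maxr.
move=> k; have [mF Fk] := Foo k; have [mG Gk] := Goo k; split.
  rewrite -[X in measurable X]setTI; apply: measurable_rV_uncons => //.
  exact: measurableX.
rewrite /pushcons /pushforward -comp_preimage.
rewrite (_ : _ \o _ = id); last by apply/funext => z /=; rewrite rV_consK.
by rewrite preimage_id product_measure1E// lte_mul_pinfty// ge0_fin_numE.
Qed.

Lemma lebesgue_rV_borel_sigma_finite n :
  exists m : {sigma_finite_measure set (rV_borel R n) -> \bar R},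
    @lebesgue_rV_borel n = m.
Proof.
elim: n => [|n [m mE]].
  by exists (@dirac _ (rV_borel R 0) (0%R : 'rV[R]_0) R).
pose H := Measure_isSigmaFinite.Build _ _ _ (pushcons_measure m)
  (pushcons_sigma_finite m).
pose M : {sigma_finite_measure set (rV_borel R n.+1) -> \bar R} :=
  HB.pack (Measure.sort (pushcons_measure m)) H.
exists M; apply/funext => A; rewrite /= /pushforward /product_measure1.
apply: eq_integral => x _; rewrite mE /xsection; congr (m _).
by apply/seteqP; split => v /=; rewrite ?inE.
Qed.

Let leb0 n : @lebesgue_rV_borel n set0 = 0.
Proof. by have [m ->] := lebesgue_rV_borel_sigma_finite n. Qed.

Let leb_ge0 n A : 0 <= @lebesgue_rV_borel n A.
Proof. by have [m ->] := lebesgue_rV_borel_sigma_finite n. Qed.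

Let leb_sigma_additive n : semi_sigma_additive (@lebesgue_rV_borel n).
Proof.
have [m ->] := lebesgue_rV_borel_sigma_finite n.
exact: measure_semi_sigma_additive.
Qed.

HB.instance Definition _ n := isMeasure.Build _ _ _ (@lebesgue_rV_borel n)
  (leb0 n) (@leb_ge0 n) (@leb_sigma_additive n).

Let leb_sigma_finite n : sigma_finite setT (@lebesgue_rV_borel n).
Proof.
have [m ->] := lebesgue_rV_borel_sigma_finite n.
exact: sigma_finiteT.
Qed.

HB.instance Definition _ n := Measure_isSigmaFinite.Build _ _ _
  (@lebesgue_rV_borel n) (@leb_sigma_finite n).

End lebesgue_rV_borel.
Arguments lebesgue_rV_borel {R} n.

(* R^n with the sigma-algebra of Lebesgue-measurable sets. *)
Notation rV_lebesgue R n :=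
  (caratheodory_type (mu_ext (@lebesgue_rV_borel R n))).

Definition lebesgue_rV {R : realType} (n : nat) : set _ -> \bar R :=
  @completed_measure_extension _ _ _ (@lebesgue_rV_borel R n).
HB.instance Definition _ (R : realType) n := Measure.on (@lebesgue_rV R n).

Lemma lebesgue_rV_sigma_finite (R : realType) n :
  sigma_finite setT (@lebesgue_rV R n).
Proof.
by apply: completed_measure_extension_sigma_finite; exact: sigma_finiteT.
Qed.
HB.instance Definition _ (R : realType) n := Measure_isSigmaFinite.Build _ _ _
  (@lebesgue_rV R n) (@lebesgue_rV_sigma_finite R n).

(* Iterated directional derivatives: this is C^k only for finite-dimensional V. *)
Fixpoint class_C (R : realType) (V W : normedModType R) (k : nat)
    (f : V -> W) : Prop :=
  match k with
  | 0 => continuous f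
  | j.+1 => (forall x, differentiable f x) /\
            (forall v : V, class_C j (fun x => 'D_v f x))
  end.

Definition smooth (R : realType) (V W : normedModType R) (f : V -> W) : Prop :=
  forall k, class_C k f.

Definition dilation (R : realType) (N : nat) (v : 'I_N -> R) (r : R)
    (x : 'rV[R]_N) : 'rV[R]_N := \row_i (r `^ v i * x ord0 i).

(* dilation v r is linear and bijective for r > 0, so hg_dilation says that it is
   an automorphism of the Lie group. *)
Record homogeneous_group (R : realType) (N : nat) := HomogeneousGroup {
  hg_mul : 'rV[R]_N -> 'rV[R]_N -> 'rV[R]_N;
  hg_inv : 'rV[R]_N -> 'rV[R]_N;
  hg_one : 'rV[R]_N;
  hg_weight : 'I_N -> R;
  hg_mulA : associative hg_mul;
  hg_mul1 : left_id hg_one hg_mul;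
  hg_mulV : left_inverse hg_one hg_inv hg_mul;
  hg_mul_smooth :
    smooth (fun z : 'rV[R]_N * 'rV[R]_N => hg_mul z.1 z.2);
  hg_inv_smooth : smooth hg_inv;
  hg_weight_gt0 : forall i, 0 < hg_weight i;
  hg_dilation : forall r, 0 < r ->
    {morph dilation hg_weight r : x y / hg_mul x y} }.

Definition homogeneous_dimension (R : realType) (N : nat)
  (G : homogeneous_group R N) : R := \sum_i hg_weight G i.

Record quasi_norm (R : realType) (N : nat) (G : homogeneous_group R N)
    (nrm : 'rV[R]_N -> R) : Prop := QuasiNorm {
  qn_continuous : continuous nrm;
  qn_ge0 : forall x, 0 <= nrm x;
  qn_inv : forall x, nrm (hg_inv G x) = nrm x;
  qn_dilation : forall x r, 0 < r ->
    nrm (dilation (hg_weight G) r x) = r * nrm x;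
  qn_eq0 : forall x, nrm x = 0 <-> x = 0 }.

Definition qball (R : realType) (N : nat) (nrm : 'rV[R]_N -> R) (r : R) :
  set (rV_lebesgue R N) := [set y | nrm y < r].

(* |B(0,|x|)|; it is finite when nrm is a quasi-norm. *)
Definition qball_volume (R : realType) (N : nat) (nrm : 'rV[R]_N -> R)
  (x : 'rV[R]_N) : R := fine (lebesgue_rV (qball nrm (nrm x))).

(* The inner integral is -oo (and expeR -oo = 0) when the positive and negative
   parts of its integrand both have infinite integral.  If this happens at some
   x != 0, then the right-hand integral is +oo, so this convention plays no role. *)
Definition exp_inequality (R : realType) (N : nat) (nrm : 'rV[R]_N -> R)
    (p q a b eps C : R) : Prop :=
  let V := qball_volume nrm in
  let mu := @lebesgue_rV R N in
  forall f : rV_lebesgue R N -> R,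
    measurable_fun setT f -> (forall x, 0 < f x) ->
    ((\int[mu]_x
        ((expeR ((eps * V x `^ eps)%:E *
                 \int[mu]_(y in ~` qball nrm (nrm x))
                   (V y `^ (- eps - 1) * ln (f y))%:E)) `^ q
         * (V x `^ a)%:E)) `^ q^-1
     <= C%:E * (\int[mu]_x (f x `^ p * V x `^ b)%:E) `^ p^-1)%E.

(* Main.v *)
Require Import Defs.
From HB Require Import structures.
From mathcomp Require Import all_boot all_order all_algebra.
From mathcomp Require Import all_classical all_reals all_analysis.
From mathcomp Require Import measurable_realfun ring lra.

Set Implicit Arguments.
Unset Strict Implicit.
Unset Printing Implicit Defensive.

Import Order.TTheory GRing.Theory Num.Theory.
Import numFieldNormedType.Exports.

Local Open Scope classical_set_scope.
Local Open Scope ring_scope.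

(** Write V x for the volume of the quasi-ball through x.  Dilations multiply
    Lebesgue measure by r^Q, so V is a positive multiple of nrm^Q, and the set
    where V < t has measure t: the image of Lebesgue measure under V is
    Lebesgue measure on the positive half-line.  This reduces the theorem to
    sigma-finite measure spaces that carry a function with this property
    ([volume_function]).

    On V >= s the weight eps s^eps V^(-eps-1) is a probability density, so the
    exponential of the inner integral is a geometric mean of f.  Put
    g = f^p V^b, r = q / p >= 1, and let G be the integral of g.

    Upper bound.  Jensen for ln, applied to V g rather than to g
    ([ln_jensen_tail]), bounds the geometric mean with s = V x by the power 1/p
    of m s^(-b-1) exp (-(b+1)/eps), where m = eps s^eps h and h is the integral
    of V^(-eps) g over V >= s.  Raised to the power q and multiplied by s^a, the
    balance p (a + 1) = q (b + 1) turns this into a multiple of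
    s^(eps r - 1) h^r.  A second Jensen, for the power r and the probability
    density g / G ([powR_jensen_tail]), moves the power inside the integral:
    h^r <= G^(r-1) times the integral of V^(-eps r) g over V >= s.  What is left
    is linear in g, and exchanging the two integrals ([integral_tail_kernel_le])
    bounds it by G / (eps r).  The constants multiply to [jensen_constant].

    Lower bound and necessity.  Choose f such that f^p V^b equals V^(-eps-1) on
    V >= lam and a small constant below ([two_power_test]).  On V >= lam the
    geometric mean only sees a power of V and is computed exactly, so the
    inequality restricted to V >= lam compares two explicit powers of lam.
    If it holds for every lam, the exponents agree, which is the balance; at
    lam = 1, letting the small constant tend to 0 gives the lower bound.

    For a fixed f the admissible constants form a closed set, hence the infimum
    of the admissible constants is admissible, and it is the least one. *)

(** * Monotonicity of the integral *)

(** The outer integrand of the inequality contains an inner integral that can be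
    infinite and whose measurability in the outer variable is not evident.  The
    integral is a difference of suprema over simple functions, so monotonicity
    holds for arbitrary functions. *)
Section monotone_integral.
Context d (T : measurableType d) (R : realType).
Variable mu : {measure set T -> \bar R}.
Implicit Types (D : set T) (f g : T -> \bar R).
Local Open Scope ereal_scope.

Lemma ge0_le_integral_nomeas D f g :
  (forall x, D x -> 0 <= f x) -> (forall x, D x -> f x <= g x) ->
  \int[mu]_(x in D) f x <= \int[mu]_(x in D) g x.
Proof.
move=> f0 fg; rewrite !ge0_integralE//; last first.
  by move=> x Dx; rewrite (le_trans (f0 _ Dx))// fg.
apply: le_ereal_sup => _ [h hf <-]; exists h => // x.
by rewrite (le_trans (hf x))//; exact: lee_restrict.
Qed.

(** f^+ <= g^+ and g^- <= f^-, and subtraction of extended reals is monotone even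
    where both terms are infinite. *)
Lemma le_integral_nomeas D f g : (forall x, D x -> f x <= g x) ->
  \int[mu]_(x in D) f x <= \int[mu]_(x in D) g x.
Proof.
move=> fg; rewrite (integralE _ _ f) (integralE _ _ g); apply: leeB;
  apply: ge0_le_integral_nomeas => // x Dx.
- by rewrite !funeposE ge_max le_max fg//= le_max lexx orbT.
- by rewrite !funenegE ge_max !le_max leeN2 fg//= lexx orbT.
Qed.

Lemma ge0_subset_integral_nomeas (D D' : set T) f : D `<=` D' ->
  (forall x, D' x -> 0 <= f x) ->
  \int[mu]_(x in D) f x <= \int[mu]_(x in D') f x.
Proof.
move=> DD' f0; rewrite [leLHS]integral_mkcond [leRHS]integral_mkcond.
apply: ge0_le_integral_nomeas => x _.
  by apply: erestrict_ge0 => t /DD' /f0.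
by apply: restrict_lee.
Qed.

End monotone_integral.

(** All that the inequality retains of a quasi-norm: V pushes [mu] forward to
    Lebesgue measure on the positive half-line. *)
Definition volume_function d (T : measurableType d) (R : realType)
    (mu : set T -> \bar R) (V : T -> R) :=
  [/\ measurable_fun setT V, forall x, 0 <= V x &
      forall t, 0 < t -> mu [set x | V x < t] = t%:E].

Section volume_function.
Context d (T : measurableType d) (R : realType).
Variables (mu : {measure set T -> \bar R}) (V : T -> R).
Hypothesis VP : volume_function mu V.
Notation leb := (@lebesgue_measure R).
Local Open Scope ereal_scope.

Let mV : measurable_fun setT V. Proof. by case: VP. Qed.
Let muV t : (0 < t)%R -> mu [set x | (V x < t)%R] = t%:E.
Proof. by case: VP => _ _; exact. Qed.

Let mpreV (A : set R) : measurable A -> measurable (V @^-1` A).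
Proof. by move=> mA; rewrite -[_ @^-1` _]setTI; exact: mV. Qed.

Let mVlt t : measurable [set x | (V x < t)%R].
Proof.
rewrite (_ : [set x | _] = V @^-1` `]-oo, t[); last first.
  by apply/seteqP; split => x /=; rewrite in_itv.
exact: mpreV.
Qed.

Let mVle t : measurable [set x | (V x <= t)%R].
Proof.
rewrite (_ : [set x | _] = V @^-1` `]-oo, t]); last first.
  by apply/seteqP; split => x /=; rewrite in_itv.
exact: mpreV.
Qed.

Lemma volume_le t : (0 <= t)%R -> mu [set x | (V x <= t)%R] = t%:E.
Proof.
move=> t0; apply/eqP; rewrite eq_le; apply/andP; split.
  apply/lee_addgt0Pr => e e0; rewrite -EFinD -muV ?ltr_wpDl//.
  by apply: le_measure; rewrite ?inE// => x /= Vt; rewrite (le_lt_trans Vt)// ltrDl.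
move: t0; rewrite [in X in X -> _]le_eqVlt => /predU1P[<-//|t0].
by rewrite -muV//; apply: le_measure; rewrite ?inE// => x /= /ltW.
Qed.

(** The image measure is only known on the positive half-line.  It is completed
    by Lebesgue measure on the negative one, so that the uniqueness of Lebesgue
    measure among measures on the whole line applies. *)
Lemma pushforward_volume (A : set R) : measurable A -> A `<=` `]0%R, +oo[ ->
  mu (V @^-1` A) = leb A.
Proof.
move=> mA A0.
have mpos : measurable (`]0%R, +oo[%classic : set (measurableTypeR R)) by [].
have mneg : measurable (`]-oo, 0%R]%classic : set (measurableTypeR R)) by [].
have mV' : measurable_fun setT (V : T -> measurableTypeR R) by exact: mV.
pose push : {measure set (measurableTypeR R) -> \bar R} :=
  measure_function_pushforward__canonical__measure_function_Measure mu mV'.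
pose m : {measure set (measurableTypeR R) -> \bar R} :=
  measure_add (mrestr push mpos) (mrestr leb mneg).
have mE X : m X = mu (V @^-1` (X `&` `]0%R, +oo[)) + leb (X `&` `]-oo, 0%R]).
  rewrite -[LHS]/(measure_add (mrestr push mpos) (mrestr leb mneg) X).
  exact: measure_addE.
have /(_ A mA) : forall A, measurable A -> leb A = m A.
  apply: lebesgue_measure_unique => _ [[a b] _ <-] /=; rewrite mE.
  rewrite [in LHS](_ : `]a, b]%classic = (`]a, b] `&` `]-oo, 0%R]) `|`
      (`]a, b] `&` `]0%R, +oo[)); last first.
    rewrite -setIUr (_ : _ `|` _ = setT) ?setIT//; apply/seteqP; split => // x _.
    by rewrite /= !in_itv/= andbT; case: (leP x 0%R); [left|right].
  rewrite measureU//; [|exact: measurableI|exact: measurableI|]; last first.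
    apply/seteqP; split => // x [[_ +] [_]].
    by rewrite /= !in_itv/= andbT => /le_lt_trans h /h; rewrite ltxx.
  rewrite addeC; congr (_ + _).
  pose a' := Num.max a 0%R.
  rewrite (_ : _ `&` _ = `]a', b]%classic); last first.
    apply/seteqP; split => x; rewrite /= !in_itv/= andbT gt_max.
      by case=> /andP[-> ->] ->.
    by case/andP => /andP[-> ->] ->.
  have a'0 : (0 <= a')%R by rewrite le_max lexx orbT.
  have [a'b|ba'] := ltP a' b; last first.
    by rewrite set_itv_ge ?bnd_simp ?ltNge ?ba'// preimage_set0 !measure0.
  rewrite (_ : V @^-1` _ =
    [set x | (V x <= b)%R] `\` [set x | (V x <= a')%R]); last first.
    apply/seteqP; split => x /=; rewrite in_itv/=.
      by move=> /andP[h ->]; split => //; apply/negP; rewrite -ltNge.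
    by move=> [-> /negP]; rewrite -ltNge => ->.
  have b0 : (0 <= b)%R by rewrite (le_trans a'0)// ltW.
  rewrite measureD//; last by rewrite [X in X < _](volume_le b0) ltry.
  rewrite setIidr; last by move=> x /= /le_trans; apply; exact: ltW.
  rewrite [X in _ = X - _](volume_le b0) [X in _ = _ - X](volume_le a'0).
  by apply: etrans (lebesgue_measure_itv _) _; rewrite /= lte_fin a'b.
rewrite mE setIidl// => ->.
rewrite [X in leb X](_ : _ = set0) ?measure0 ?adde0//.
apply/seteqP; split => // x [/A0 + ]; rewrite /= !in_itv/= andbT.
by move=> /lt_le_trans h /h; rewrite ltxx.
Qed.

Lemma integral_comp_volume (D : set R) (f : R -> \bar R) :
  measurable D -> D `<=` `]0%R, +oo[ -> measurable_fun D f ->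
  (forall t, D t -> 0 <= f t) ->
  \int[mu]_(x in V @^-1` D) f (V x) = \int[leb]_(t in D) f t.
Proof.
move=> mD D0 mf f0.
have mV' : measurable_fun setT (V : T -> measurableTypeR R) by exact: mV.
pose push : {measure set (measurableTypeR R) -> \bar R} :=
  measure_function_pushforward__canonical__measure_function_Measure mu mV'.
transitivity (\int[push]_(t in D) f t).
  by apply/esym/ge0_integral_pushforward => // t; rewrite inE => /f0.
apply: eq_measure_integral => A mA AD.
by apply: pushforward_volume => //; exact: subset_trans AD D0.
Qed.

End volume_function.

(** * Powers and logarithms on the positive half-line *)

Section power_calculus.
Context (R : realType).
Implicit Types (c s t : R).

Lemma powR_le_mono c : 0 < c -> {in Num.nneg &, {mono (@powR R ^~ c) : x y / x <= y}}.
Proof. by move=> c0; apply: le_mono_in; exact: gt0_ltr_powR. Qed.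

Lemma powRVK c t : 0 < c -> 0 <= t -> (t `^ c^-1) `^ c = t.
Proof. by move=> c0 t0; rewrite -powRrM mulVf ?powRr1// gt_eqF. Qed.

Lemma continuous_powR c t : 0 < t -> {for t, continuous (@powR R ^~ c)}.
Proof.
move=> t0; apply: differentiable_continuous; apply/derivable1_diffP.
by apply: derivable_powR; rewrite in_itv/= t0.
Qed.

Lemma powR_cvg0y c : 0 < c -> t `^ (- c) @[t --> +oo] --> 0.
Proof.
move=> c0; apply/cvgr0Pnorm_lt => e e0; near=> t.
have t0 : 0 < t by near: t; exact: nbhs_pinfty_gt.
have et : e `^ (- c^-1) < t by near: t; apply: nbhs_pinfty_gt; rewrite num_real.
rewrite ger0_norm ?powR_ge0// powRN -[ltRHS]invrK.
rewrite ltf_pV2 ?posrE ?invr_gt0 ?powR_gt0//.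
rewrite [ltLHS](_ : _ = (e `^ (- c^-1)) `^ c).
  by rewrite gt0_ltr_powR// ?nnegrE ?powR_ge0// ltW.
by rewrite -powRrM mulNr mulVf ?gt_eqF// powR_inv1// ltW.
Unshelve. all: by end_near. Qed.

Lemma is_derive_powR_tail c t : 0 < c -> 0 < t ->
  is_derive t 1 (fun u => - (c^-1 * u `^ (- c))) (t `^ (- c - 1)).
Proof.
move=> c0 t0; have ? := is_derive1_powR (- c) t0.
apply: is_derive_eq; rewrite /GRing.scale/=; field.
by rewrite gt_eqF.
Qed.

Lemma is_derive_ln_powR_tail c s t : 0 < c -> 0 < s -> 0 < t ->
  is_derive t 1
    (fun u => - (c^-1 * (u `^ (- c) * (ln u - ln s)) + c^-1 * (c^-1 * u `^ (- c))))
    (t `^ (- c - 1) * (ln t - ln s)).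
Proof.
move=> c0 s0 t0; have ? := is_derive1_powR (- c) t0.
have ? := is_derive1_ln t0.
apply: is_derive_eq; rewrite /GRing.scale/=.
have -> : t `^ (- c) = t `^ (- c - 1) * t.
  by rewrite -{3}(powRr1 (ltW t0)) -powRD ?subrK// (gt_eqF t0) implybT.
by field; rewrite !gt_eqF.
Qed.

(** Squeeze, from ln u < u at u = t^(c/2). *)
Lemma ln_powR_cvg0y c s : 0 < c -> t `^ (- c) * (ln t - ln s) @[t --> +oo] --> 0.
Proof.
move=> c0.
have c20 : 0 < c / 2 by rewrite divr_gt0.
have : (c / 2)^-1 * t `^ (- (c / 2)) @[t --> +oo] --> (0 : R).
  by rewrite -[X in _ --> X](mulr0 (c / 2)^-1); apply: cvgMr; exact: powR_cvg0y.
have lns : ln s * t `^ (- c) @[t --> +oo] --> (0 : R).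
  by rewrite -[X in _ --> X](mulr0 (ln s)); apply: cvgMr; exact: powR_cvg0y.
move=> h.
have : t `^ (- c) * ln t @[t --> +oo] --> (0 : R).
  apply: squeeze_cvgr (cvg_cst _) h.
  near=> t.
  have t1 : 1 <= t by near: t; apply: nbhs_pinfty_ge; rewrite num_real.
  have t0 : 0 < t by exact: lt_le_trans t1.
  rewrite mulr_ge0 ?powR_ge0 ?ln_ge0//=.
  rewrite [X in t `^ (- X)](_ : c = c / 2 + c / 2); last by field.
  rewrite opprD powRD ?(gt_eqF t0) ?implybT// -mulrA [leRHS]mulrC.
  rewrite ler_pM2l ?powR_gt0// powRN mulrC ler_pdivrMr ?powR_gt0//.
  rewrite -(ler_pM2l c20) mulrA divff ?mul1r ?gt_eqF// -ln_powR.
  by apply/ltW/ln_sublinear/powR_gt0.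
move=> /cvgB/(_ lns); rewrite subr0; apply: cvg_trans.
apply: near_eq_cvg; near=> t; by rewrite !fctE mulrBr [_ * ln s]mulrC.
Unshelve. all: by end_near. Qed.

Local Notation leb := (@lebesgue_measure R).

Lemma within_continuous_gt0 (A : set R) (f : R -> R) : A `<=` `]0, +oo[ ->
  (forall t, 0 < t -> {for t, continuous f}) -> {within A, continuous f}.
Proof.
move=> A0 cf; apply: continuous_in_subspaceT => t /[!inE] /A0 /=.
by rewrite in_itv/= andbT; exact: cf.
Qed.

Lemma FTC_tail (f F : R -> R) s : 0 < s ->
  (forall t, s <= t -> 0 <= f t) -> (forall t, 0 < t -> {for t, continuous f}) ->
  (forall t, 0 < t -> is_derive t 1 F (f t)) -> F t @[t --> +oo] --> 0 ->
  (\int[leb]_(t in `[s, +oo[) (f t)%:E = (- F s)%:E)%E.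
Proof.
move=> s0 f0 cf dF F0.
rewrite (@ge0_continuous_FTC2y _ f F s 0)//.
- by rewrite sub0e.
- apply: within_continuous_gt0 => // t /=; rewrite !in_itv/= !andbT.
  exact: lt_le_trans.
- by move=> t st; have [] := dF t (lt_trans s0 st).
- apply: cvg_at_right_filter; apply: differentiable_continuous.
  by apply/derivable1_diffP; have [] := dF s s0.
- move=> t; rewrite in_itv/= andbT => st; rewrite derive1E.
  by have [_ ->] := dF t (lt_trans s0 st).
Qed.

Lemma integral_powR_tail c s : 0 < c -> 0 < s ->
  (\int[leb]_(t in `[s, +oo[) (t `^ (- c - 1))%:E = (c^-1 * s `^ (- c))%:E)%E.
Proof.
move=> c0 s0.
rewrite (@FTC_tail _ _ s s0 _ _ (fun t => @is_derive_powR_tail c t c0))//.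
- by rewrite opprK.
- by move=> t _; exact: powR_ge0.
- by move=> t; exact: continuous_powR.
- rewrite -oppr0 -(mulr0 c^-1); apply: cvgN; apply: cvgMr; exact: powR_cvg0y.
Qed.

Lemma integral_ln_powR_tail c s : 0 < c -> 0 < s ->
  (\int[leb]_(t in `[s, +oo[) (t `^ (- c - 1) * (ln t - ln s))%:E =
   (c^-1 * (c^-1 * s `^ (- c)))%:E)%E.
Proof.
move=> c0 s0.
rewrite (@FTC_tail _ _ s s0 _ _ (fun t => @is_derive_ln_powR_tail c s t c0 s0))//.
- by rewrite subrr !mulr0 add0r opprK.
- move=> t st; have t0 := lt_le_trans s0 st.
  by rewrite mulr_ge0 ?powR_ge0// subr_ge0 ler_ln.
- move=> t t0; apply: cvgM; first exact: continuous_powR.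
  by apply: cvgB; [exact: continuous_ln|exact: cvg_cst].
- rewrite -oppr0 -(addr0 0) -{1}(mulr0 c^-1) -{2}(mulr0 c^-1) -{2}(mulr0 c^-1).
  apply: cvgN; apply: cvgD; apply: cvgMr; first exact: ln_powR_cvg0y.
  by apply: cvgMr; exact: powR_cvg0y.
Qed.

(** Stated as an inequality, so that the bound does not depend on the lower end
    point and survives the limit s --> 0. *)
Lemma integral_powR_le c s t : 0 < c -> 0 < s ->
  (\int[leb]_(u in `[s, t]) (u `^ (c - 1))%:E <= (c^-1 * t `^ c)%:E)%E.
Proof.
move=> c0 s0.
have [st|ts] := ltP s t; last first.
  rewrite (@integral_Sset1 _ _ _ s) ?lee_fin ?mulr_ge0 ?invr_ge0 ?powR_ge0 ?ltW//.
  move=> u /=; rewrite in_itv/= => /andP[su ut].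
  by apply/eqP; rewrite eq_le su (le_trans ut).
have dF (u : R) : 0 < u -> is_derive u 1 (fun v => c^-1 * v `^ c) (u `^ (c - 1)).
  move=> u0; have ? := is_derive1_powR c u0.
  by apply: is_derive_eq; rewrite /GRing.scale/= mulrA mulVf ?mul1r ?gt_eqF.
have cF (u : R) : 0 < u -> {for u, continuous (fun v => c^-1 * v `^ c)}.
  move=> u0; apply: differentiable_continuous.
  by apply/derivable1_diffP; have [] := dF u u0.
rewrite (@continuous_FTC2 _ (fun u => u `^ (c - 1)) (fun u => c^-1 * u `^ c) s t)//.
- by rewrite -EFinB lee_fin gerBl mulr_ge0 ?invr_ge0 ?powR_ge0// ltW.
- apply: within_continuous_gt0 => [u /=|u]; last exact: continuous_powR.
  by rewrite !in_itv/= andbT => /andP[/(lt_le_trans s0)].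
- split.
  + by move=> u /[!in_itv]/= /andP[su _]; have [] := dF u (lt_trans s0 su).
  + by apply: cvg_at_right_filter; exact: cF.
  + by apply: cvg_at_left_filter; apply: cF; exact: lt_trans st.
- move=> u /[!in_itv]/= /andP[su _]; rewrite derive1E.
  by have [_ ->] := dF u (lt_trans s0 su).
Qed.

Lemma integral_powR0_le c t : 0 < c ->
  (\int[leb]_(u in `]0%R, t]) (u `^ (c - 1))%:E <= (c^-1 * t `^ c)%:E)%E.
Proof.
move=> c0.
rewrite (_ : `]0, t]%classic = \bigcup_n `[n.+1%:R^-1, t]%classic); last first.
  apply/seteqP; split => u /=; rewrite in_itv/=.
    move=> /andP[u0 ut].
    exists (Num.truncn u^-1) => //=; rewrite in_itv/= ut andbT.
    by rewrite invf_ple ?posrE// ltW// truncnS_gt.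
  by move=> [n _] /=; rewrite in_itv/= => /andP[/(lt_le_trans _)->].
have mf n : measurable_fun (`[n.+1%:R^-1, t]%classic : set R)
    (fun u => (u `^ (c - 1))%:E).
  by apply/measurable_EFinP; apply: measurable_funTS; exact: measurable_powR.
pose F n : set (measurableTypeR R) := `[n.+1%:R^-1, t]%classic.
apply: (cvge_le _ (@ge0_nondecreasing_set_cvg_integral _ _ R F
  (fun u => (u `^ (c - 1))%:E) leb _ _ _ _)) => //.
- by near=> n; exact: integral_powR_le.
- apply/nondecreasing_seqP => n; rewrite subsetEset; apply: subset_itvr.
  by rewrite bnd_simp lef_pV2 ?posrE// ler_nat.
- by move=> n; exact: measurable_itv.
- by move=> n u _; rewrite lee_fin powR_ge0.
Unshelve. all: by end_near.
Qed.

End power_calculus.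

(** * Integrals of functions of the volume *)

Section has_integral.
Context d (T : measurableType d) (R : realType).
Variables (mu : {measure set T -> \bar R}) (D : set T).
Hypothesis mD : measurable D.
Implicit Types (u v : T -> R) (i j k : R).

(** Integrability bundled with the finite value, so that integrals of linear
    combinations of explicit functions of either sign can be read off. *)
Definition has_integral u i :=
  mu.-integrable D (EFin \o u) /\ (\int[mu]_(x in D) (u x)%:E = i%:E)%E.

Lemma ge0_has_integral u i : measurable_fun D u -> (forall x, D x -> 0 <= u x) ->
  (\int[mu]_(x in D) (u x)%:E = i%:E)%E -> has_integral u i.
Proof.
move=> mfu u0 ui; split => //; apply/integrableP; split.
  exact/measurable_EFinP.
under eq_integral => x /[!inE] Dx do rewrite /= ger0_norm ?u0//.
by rewrite ui ltry.
Qed.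

Lemma has_integralD u v i j : has_integral u i -> has_integral v j ->
  has_integral (fun x => u x + v x) (i + j).
Proof.
move=> [iu ui] [iv vj]; split; first exact: (integrableD mD iu iv).
by under eq_integral do rewrite EFinD; rewrite integralD// ui vj.
Qed.

Lemma has_integralZ k u i : has_integral u i ->
  has_integral (fun x => k * u x) (k * i).
Proof.
move=> [iu ui]; split; first exact: (integrableZl mD k iu).
by under eq_integral do rewrite EFinM; rewrite integralZl// ui.
Qed.

End has_integral.

Section volume_integrals.
Context d (T : measurableType d) (R : realType).
Variables (mu : {measure set T -> \bar R}) (V : T -> R).
Hypothesis VP : volume_function mu V.

Lemma measurable_volume : measurable_fun setT V. Proof. by case: VP. Qed.

Lemma measurable_volume_itv (i : interval R) : measurable (V @^-1` [set` i]).
Proof. by rewrite -[_ @^-1` _]setTI; apply: measurable_volume. Qed.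

Lemma volume_tailE s : [set x | s <= V x] = V @^-1` `[s, +oo[.
Proof. by apply/seteqP; split => x; rewrite /= in_itv/= andbT. Qed.

Lemma measurable_volume_tail s : measurable [set x | s <= V x].
Proof. by rewrite volume_tailE; exact: measurable_volume_itv. Qed.

Lemma measurable_volume_powR (D : set T) c : measurable_fun D (fun y => V y `^ c).
Proof.
apply: measurable_funTS.
exact: (measurableT_comp (measurable_powR c) measurable_volume).
Qed.

Let integral_tail s (f : R -> R) : 0 < s -> measurable_fun setT f ->
  (forall t, s <= t -> 0 <= f t) ->
  (\int[mu]_(x in [set x | (s <= V x)%R]) (f (V x))%:E =
   \int[@lebesgue_measure R]_(t in `[s, +oo[) (f t)%:E)%E.
Proof.
move=> s0 mf f0; rewrite volume_tailE.
apply: (@integral_comp_volume _ _ _ _ _ VP _ (EFin \o f)).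
- exact: measurable_itv.
- by move=> t /=; rewrite !in_itv/= !andbT; exact: lt_le_trans.
- by apply/measurable_EFinP; exact: measurable_funTS.
- by move=> t /=; rewrite in_itv/= andbT lee_fin; exact: f0.
Qed.

Lemma integral_volume_tail c s : 0 < c -> 0 < s ->
  (\int[mu]_(x in [set x | (s <= V x)%R]) (V x `^ (- c - 1))%:E =
   (c^-1 * s `^ (- c))%:E)%E.
Proof.
move=> c0 s0; rewrite (integral_tail (f := fun t => t `^ (- c - 1)))//.
- exact: integral_powR_tail.
- by move=> t _; exact: powR_ge0.
Qed.

Lemma integral_ln_volume_tail c s : 0 < c -> 0 < s ->
  (\int[mu]_(x in [set x | (s <= V x)%R])
     (V x `^ (- c - 1) * (ln (V x) - ln s))%:E =
   (c^-1 * (c^-1 * s `^ (- c)))%:E)%E.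
Proof.
move=> c0 s0.
rewrite (integral_tail (f := fun t => t `^ (- c - 1) * (ln t - ln s)))//.
- exact: integral_ln_powR_tail.
- apply: measurable_funM; first exact: measurable_powR.
  by apply: measurable_funB => //; exact: measurable_ln.
- move=> t st; have t0 := lt_le_trans s0 st.
  by rewrite mulr_ge0 ?powR_ge0// subr_ge0 ler_ln.
Qed.

Lemma has_integral_volume_tail c s : 0 < c -> 0 < s ->
  has_integral mu [set x | s <= V x] (fun x => V x `^ (- c - 1))
    (c^-1 * s `^ (- c)).
Proof.
move=> c0 s0; apply: ge0_has_integral.
- exact: measurable_volume_powR.
- by move=> x _; exact: powR_ge0.
- exact: integral_volume_tail.
Qed.

Lemma has_integral_ln_volume_tail c s : 0 < c -> 0 < s ->
  has_integral mu [set x | s <= V x]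
    (fun x => V x `^ (- c - 1) * (ln (V x) - ln s))
    (c^-1 * (c^-1 * s `^ (- c))).
Proof.
move=> c0 s0; apply: ge0_has_integral.
- apply: measurable_funM; first exact: measurable_volume_powR.
  apply: measurable_funTS; apply: measurable_funB => //.
  exact: (measurableT_comp (@measurable_ln R) measurable_volume).
- move=> x sx; rewrite mulr_ge0 ?powR_ge0// subr_ge0 ler_ln ?posrE//.
  exact: lt_le_trans sx.
- exact: integral_ln_volume_tail.
Qed.

Lemma integral_volume_head_le c t : 0 < c ->
  (\int[mu]_(x in V @^-1` `]0%R, t]) (V x `^ (c - 1))%:E <= (c^-1 * t `^ c)%:E)%E.
Proof.
move=> c0; rewrite (@integral_comp_volume _ _ _ _ _ VP _
  (fun u => (u `^ (c - 1))%:E)).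
- exact: integral_powR0_le.
- exact: measurable_itv.
- by move=> u /=; rewrite !in_itv/= andbT => /andP[].
- by apply/measurable_EFinP; apply: measurable_funTS; exact: measurable_powR.
- by move=> u _; rewrite lee_fin powR_ge0.
Qed.

Lemma negligible_volume0 : mu [set x | V x <= 0] = 0%E.
Proof. by rewrite (volume_le VP). Qed.

(** V = 0 is a null set; with g replaced by +oo there, the comparison f <= g
    holds everywhere. *)
Lemma le_integral_volume_gt0 (f g : T -> \bar R) : (forall x, 0 <= f x)%E ->
  measurable_fun setT g -> (forall x, 0 < V x -> (f x <= g x)%E) ->
  (\int[mu]_x f x <= \int[mu]_(x in [set x | (0 < V x)%R]) g x)%E.
Proof.
move=> f0 mg fg; pose N := [set x | V x <= 0].
have mN : measurable N.
  rewrite (_ : N = V @^-1` `]-oo, 0%R]); first exact: measurable_volume_itv.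
  by apply/seteqP; split => x; rewrite /= in_itv.
have NC : [set x | 0 < V x] = ~` N.
  by apply/seteqP; split => x /=; rewrite ltNge => /negP.
pose g' := fun x => if x \in N then +oo%E else g x.
have fg' x : (f x <= g' x)%E.
  rewrite /g'; case: ifPn; first by rewrite leey.
  by rewrite notin_setE => /negP; rewrite -ltNge; exact: fg.
have g'0 x : (0 <= g' x)%E by exact: le_trans (f0 x) (fg' x).
have mg' : measurable_fun setT g'.
  apply: measurable_fun_ifT => //.
  apply: (measurable_fun_bool true); rewrite setTI.
  rewrite (_ : _ @^-1` _ = N)//; apply/seteqP.
  by split => x; [exact: set_mem|exact: mem_set].
apply: (le_trans (ge0_le_integral_nomeas mu (fun x _ => f0 x) (fun x _ => fg' x))).
rewrite (ge0_negligible_integral mN)//; last exact: negligible_volume0.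
rewrite setTD NC le_eqVlt; apply/orP; left; apply/eqP.
by apply: eq_integral => x /[!inE] Nx; rewrite /g' memNset.
Qed.

End volume_integrals.

(** * Jensen inequalities on the sets V >= s *)

Section jensen.
Context (R : realType).
Implicit Types (m r t : R).

(** The tangent of ln at m.  Integrated against a probability density of which m
    is the mean, it is Jensen's inequality. *)
Lemma ln_le_tangent m t : 0 < m -> 0 < t -> ln t <= ln m - 1 + t / m.
Proof.
move=> m0 t0; have tm : 0 < t / m by rewrite divr_gt0.
have : ln (t / m) <= t / m - 1.
  by rewrite -[X in ln X](subrKC 1) le_ln1Dx// ltrBrDl subrr.
by rewrite ln_div ?posrE//; lra.
Qed.

(** The tangent of t^r at m, in the form given by Young's inequality with
    exponents r and r / (r - 1). *)
Lemma powR_ge_tangent m r t : 1 <= r -> 0 <= m -> 0 <= t ->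
  r * m `^ (r - 1) * t <= t `^ r + (r - 1) * m `^ r.
Proof.
move=> r1 m0 t0; have r0 : 0 < r by exact: lt_le_trans r1.
move: r1; rewrite le_eqVlt => /predU1P[<-|r1].
  by rewrite subrr powRr0 !mul1r mul0r addr0 powRr1.
have r10 : 0 < r - 1 by rewrite subr_gt0.
have rN0 : r != 0 by rewrite gt_eqF.
have r1N0 : r - 1 != 0 by rewrite gt_eqF.
have rr : 0 < r / (r - 1) by rewrite divr_gt0.
have rr1 : r^-1 + (r / (r - 1))^-1 = 1 by field; rewrite r1N0 rN0.
have := conjugate_powR t0 (powR_ge0 m (r - 1)) r0 rr rr1.
rewrite -powRrM (_ : (r - 1) * (r / (r - 1)) = r); last by field.
rewrite -(ler_pM2l r0) => /le_trans h.
rewrite -mulrA [m `^ _ * t]mulrC h//.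
by rewrite le_eqVlt; apply/orP; left; apply/eqP; field; rewrite r1N0 rN0.
Qed.

End jensen.

Section tail_inequalities.
Context d (T : measurableType d) (R : realType).
Variables (mu : {measure set T -> \bar R}) (V : T -> R).
Hypothesis VP : volume_function mu V.
Local Notation tail s := [set y | s <= V y].

Section weights.
Variables (g : T -> R) (G : R).
Hypotheses (mg : measurable_fun setT g) (g0 : forall y, 0 <= g y).
Hypothesis gG : (\int[mu]_y (g y)%:E = G%:E)%E.

Let mtail s : measurable (tail s). Proof. exact: measurable_volume_tail VP s. Qed.

Let mVg c (D : set T) : measurable_fun D (fun y => V y `^ c * g y).
Proof.
apply: measurable_funM; last exact: measurable_funTS.
exact: (measurable_volume_powR VP).
Qed.

Lemma integral_tail_powR_le c s : 0 <= c -> 0 < s ->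
  (\int[mu]_(y in tail s) (V y `^ (- c) * g y)%:E <= (s `^ (- c) * G)%:E)%E.
Proof.
move=> c0 s0; rewrite EFinM -gG -ge0_integralZl//; last 3 first.
- by apply/measurable_EFinP.
- by move=> y _; rewrite lee_fin.
- by rewrite lee_fin powR_ge0.
have step : (\int[mu]_(y in tail s) (V y `^ (- c) * g y)%:E <=
    \int[mu]_(y in tail s) ((s `^ (- c))%:E * (g y)%:E))%E.
  apply: ge0_le_integral_nomeas => y sy; rewrite -?EFinM lee_fin.
    by rewrite mulr_ge0 ?powR_ge0.
  rewrite ler_wpM2r// !powRN lef_pV2 ?posrE ?powR_gt0//; last exact: lt_le_trans sy.
  by rewrite ge0_ler_powR ?nnegrE ?(ltW s0)// (le_trans (ltW s0)).
apply: (le_trans step); apply: ge0_subset_integral_nomeas => // y _.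
by rewrite -EFinM lee_fin mulr_ge0 ?powR_ge0.
Qed.

Lemma has_integral_tail_powR c s : 0 <= c -> 0 < s ->
  exists2 h, 0 <= h & has_integral mu (tail s) (fun y => V y `^ (- c) * g y) h.
Proof.
move=> c0 s0; have := integral_tail_powR_le c0 s0.
have /[swap] hle : (0 <= \int[mu]_(y in tail s) (V y `^ (- c) * g y)%:E)%E.
  by apply: integral_ge0 => y _; rewrite lee_fin mulr_ge0 ?powR_ge0.
move=> h0; exists (fine (\int[mu]_(y in tail s) (V y `^ (- c) * g y)%:E)).
  exact: fine_ge0.
apply: ge0_has_integral => // [y _|]; first by rewrite mulr_ge0 ?powR_ge0.
by rewrite fineK// ge0_fin_numE// (le_lt_trans hle)// ltry.
Qed.

(** Otherwise g would vanish almost everywhere on V >= s, a set on which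
    V^(-2) has a positive integral. *)
Lemma has_integral_tail_gt0 c s h : 0 < s -> (forall y, s <= V y -> 0 < g y) ->
  has_integral mu (tail s) (fun y => V y `^ (- c) * g y) h -> 0 < h.
Proof.
move=> s0 gpos [_ hE].
have h0 : 0 <= h.
  rewrite -lee_fin -hE; apply: integral_ge0 => y _.
  by rewrite lee_fin mulr_ge0 ?powR_ge0.
rewrite lt_neqAle h0 andbT; apply/negP => /eqP h00.
have /ae_eq_integral_abs : measurable_fun (tail s)
    (fun y => (V y `^ (- c) * g y)%:E) by exact/measurable_EFinP.
move=> /(_ mu (mtail s)) [+ _].
rewrite (eq_integral (fun y => (V y `^ (- c) * g y)%:E)); last first.
  by move=> y _; rewrite gee0_abs// lee_fin mulr_ge0 ?powR_ge0.
rewrite hE -h00 => /(_ erefl) [N [mN N0 tN]].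
have := integral_volume_tail VP (@ltr01 R) s0.
rewrite null_set_integral//.
- move=> /eqP; rewrite eqe lt_eqF// mulr_gt0 ?invr_gt0// powR_gt0//.
- apply/measurable_EFinP; exact: (measurable_volume_powR VP).
- apply: (@subset_measure0 _ _ _ mu _ N) => // y sy; apply: tN => /= /(_ sy).
  move=> /eqP; rewrite eqe gt_eqF// mulr_gt0 ?gpos// powR_gt0//.
  exact: lt_le_trans sy.
Qed.

(** Jensen for the power r and the density g / G, whose mass on V >= s may be
    less than 1: the tangent inequality is integrated at m = h / G, and the
    missing mass does no harm because the constant term (r - 1) m^r is
    nonnegative. *)
Lemma powR_jensen_tail e r s h : 0 <= e -> 1 <= r -> 0 < s -> 0 < G ->
  has_integral mu (tail s) (fun y => V y `^ (- e) * g y) h ->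
  ((h `^ r)%:E <=
   (G `^ (r - 1))%:E * \int[mu]_(y in tail s) (V y `^ (- (e * r)) * g y)%:E)%E.
Proof.
move=> e0 r1 s0 G0 hh; have r0 : 0 < r by exact: lt_le_trans r1.
have h0 : 0 <= h.
  rewrite -lee_fin -hh.2; apply: integral_ge0 => y _.
  by rewrite lee_fin mulr_ge0 ?powR_ge0.
have [i i0 ii] := @has_integral_tail_powR (e * r) s (mulr_ge0 e0 (ltW r0)) s0.
rewrite ii.2 -EFinM lee_fin.
have [k k0 kk] := @has_integral_tail_powR 0 s (lexx _) s0.
have kG : k <= G.
  rewrite -lee_fin -kk.2 (le_trans (integral_tail_powR_le (lexx 0) s0))//.
  by rewrite oppr0 powRr0 mul1r.
pose m := h / G; have m0 : 0 <= m by rewrite divr_ge0// ltW.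
have : r * m `^ (r - 1) * h <= i + (r - 1) * m `^ r * k.
  rewrite -lee_fin.
  rewrite -(has_integralZ (mtail s) (r * m `^ (r - 1)) hh).2.
  rewrite -(has_integralD (mtail s) ii
    (has_integralZ (mtail s) ((r - 1) * m `^ r) kk)).2.
  apply: le_integral_nomeas => y sy; rewrite lee_fin.
  rewrite oppr0 powRr0 mul1r !mulrA -mulrDl ler_wpM2r//.
  by rewrite -mulNr powRrM; apply: powR_ge_tangent => //; exact: powR_ge0.
have : (r - 1) * m `^ r * k <= (r - 1) * (m `^ (r - 1) * h).
  rewrite -mulrA ler_wpM2l ?subr_ge0// -(mulr_powRB1 m0 r0).
  rewrite mulrAC mulrC ler_wpM2l ?powR_ge0//.
  by rewrite (le_trans (ler_wpM2l m0 kG))// /m divfK// gt_eqF.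
move=> h1 h2; have {h1 h2} : m `^ (r - 1) * h <= i.
  have := le_trans h2 (lerD (lexx i) h1); lra.
move=> mhi; have hE : h `^ (r - 1) = G `^ (r - 1) * m `^ (r - 1).
  by rewrite -powRM ?(ltW G0)// /m mulrCA divff ?mulr1// gt_eqF.
by rewrite -(mulr_powRB1 h0 r0) hE mulrCA ler_wpM2l ?powR_ge0// mulrC.
Qed.

End weights.
End tail_inequalities.

(** * The linear inequality behind the upper bound *)

Section dual_hardy.
Context d (T : measurableType d) (R : realType).
Variables (mu : {sigma_finite_measure set T -> \bar R}) (V : T -> R).
Hypothesis VP : volume_function mu V.
Variables (g : T -> R) (G e : R).
Hypotheses (mg : measurable_fun setT g) (g0 : forall y, 0 <= g y).
Hypothesis gG : (\int[mu]_y (g y)%:E = G%:E)%E.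
Hypothesis e0 : 0 < e.

Let A : set (T * T) := [set z | (0 < V z.1) && (V z.1 <= V z.2)].

(** A function on the product space, so that Tonelli's theorem also gives the
    measurability in x of the integral over V y >= V x. *)
Definition tail_kernel (z : T * T) : \bar R :=
  (V z.1 `^ (e - 1) * (V z.2 `^ (- e) * g z.2) * \1_A z)%:E.

Let mA : measurable A.
Proof.
have mV1 : measurable_fun setT (fun z : T * T => V z.1).
  exact: (measurableT_comp (measurable_volume VP) measurable_fst).
have mV2 : measurable_fun setT (fun z : T * T => V z.2).
  exact: (measurableT_comp (measurable_volume VP) measurable_snd).
have mb : measurable_fun setT (fun z : T * T => (0 < V z.1) && (V z.1 <= V z.2)).
  by apply: measurable_and; [exact: measurable_fun_ltr|exact: measurable_fun_ler].
rewrite -[A]setTI.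
rewrite (_ : A = (fun z => (0 < V z.1) && (V z.1 <= V z.2)) @^-1` [set true])//.
exact: mb.
Qed.

Let mK : measurable_fun setT tail_kernel.
Proof.
apply/measurable_EFinP; apply: measurable_funM; last exact: measurable_indic.
apply: measurable_funM.
  exact: (measurableT_comp (measurable_volume_powR VP _) measurable_fst).
apply: measurable_funM.
  exact: (measurableT_comp (measurable_volume_powR VP _) measurable_snd).
exact: (measurableT_comp mg measurable_snd).
Qed.

Let K0 z : (0 <= tail_kernel z)%E.
Proof.
by rewrite lee_fin !mulr_ge0 ?powR_ge0.
Qed.

Lemma measurable_tail_kernel :
  measurable_fun setT (fun x => \int[mu]_y tail_kernel (x, y))%E.
Proof. exact: (measurable_fun_fubini_tonelli_F _ mK K0). Qed.

Lemma tail_kernel_ge0 x : (0 <= \int[mu]_y tail_kernel (x, y))%E.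
Proof. by apply: integral_ge0. Qed.

Lemma tail_kernelE x : 0 < V x ->
  (\int[mu]_y tail_kernel (x, y) = (V x `^ (e - 1))%:E *
   \int[mu]_(y in [set y | (V x <= V y)%R]) (V y `^ (- e) * g y)%:E)%E.
Proof.
move=> Vx0; rewrite -ge0_integralZl//; last 4 first.
- exact: measurable_volume_tail VP _.
- apply/measurable_EFinP; apply: measurable_funM; last exact: measurable_funTS.
  exact: (measurable_volume_powR VP).
- by move=> y _; rewrite lee_fin mulr_ge0 ?powR_ge0.
- by rewrite lee_fin powR_ge0.
rewrite [RHS]integral_mkcond; apply: eq_integral => y _.
rewrite patchE /tail_kernel indicE/=.
have -> : ((x, y) \in A) = (y \in [set y | V x <= V y]).
  by apply/idP/idP => /set_mem; rewrite /A/= ?Vx0/= => h; apply: mem_set;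
    rewrite /= ?Vx0.
by case: ifPn => _; rewrite ?mulr1 ?mulr0// EFinM.
Qed.

(** After the exchange, the integral in x over 0 < V x <= V y of V x^(e-1) is
    V y^e / e, which cancels the factor V y^(-e). *)
Lemma integral_tail_kernel_le :
  (\int[mu]_x \int[mu]_y tail_kernel (x, y) <= (e^-1 * G)%:E)%E.
Proof.
rewrite (fubini_tonelli _ mK K0) EFinM -gG -ge0_integralZl//; last 3 first.
- by apply/measurable_EFinP.
- by move=> y _; rewrite lee_fin.
- by rewrite lee_fin invr_ge0 ltW.
apply: ge0_le_integral_nomeas => y _; first by apply: integral_ge0.
have vg0 : 0 <= V y `^ (- e) * g y by rewrite mulr_ge0 ?powR_ge0.
have -> : (\int[mu]_x tail_kernel (x, y) = (V y `^ (- e) * g y)%:E *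
    \int[mu]_(x in V @^-1` `]0%R, V y]) (V x `^ (e - 1))%:E)%E.
  rewrite -ge0_integralZl//; last 3 first.
  - exact: measurable_volume_itv VP _.
  - apply/measurable_EFinP; exact: (measurable_volume_powR VP).
  - by move=> x _; rewrite lee_fin powR_ge0.
  rewrite [RHS]integral_mkcond; apply: eq_integral => x _.
  rewrite patchE /tail_kernel indicE/=.
  have -> : ((x, y) \in A) = (x \in V @^-1` `]0%R, V y]).
    apply/idP/idP => /set_mem; rewrite /A/= => h; apply: mem_set => /=;
      by rewrite in_itv/= in h *.
  by case: ifPn => _; rewrite ?mulr1 ?mulr0// mulrC EFinM.
apply: (le_trans (lee_wpmul2l _ (integral_volume_head_le VP _ e0))).
  by rewrite lee_fin.
rewrite -!EFinM lee_fin mulrCA ler_wpM2l ?invr_ge0 ?(ltW e0)//.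
rewrite mulrAC -[leRHS]mul1r ler_wpM2r// powRN.
by have [->|h] := eqVneq (V y `^ e) 0; rewrite ?mulr0// mulVf.
Qed.

End dual_hardy.

Section log_jensen.
Context d (T : measurableType d) (R : realType).
Variables (mu : {measure set T -> \bar R}) (V : T -> R).
Hypothesis VP : volume_function mu V.
Local Notation tail s := [set y | s <= V y].

(** Jensen for ln with respect to the density eps s^eps V^(-eps-1), applied to
    V f^p V^b, whose mean is m = eps s^eps h.  Multiplying by V first turns the
    weight V^(-eps-1) into V^(-eps); the price is the logarithmic moment of V,
    which is exactly ln s + 1 / eps. *)
Lemma ln_jensen_tail (f : T -> R) (p b eps s h : R) :
  (forall x, 0 < f x) -> 0 < p -> 0 < eps -> 0 < s -> 0 < h ->
  has_integral mu (tail s)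
    (fun y => V y `^ (- eps) * (f y `^ p * V y `^ b)) h ->
  ((eps * s `^ eps)%:E *
     \int[mu]_(y in tail s) (V y `^ (- eps - 1) * ln (f y))%:E <=
   (p^-1 * (ln (eps * s `^ eps * h) - (b + 1) * (ln s + eps^-1)))%:E)%E.
Proof.
move=> f0 p0 eps0 s0 h0 ih.
have se0 : 0 < s `^ eps by rewrite powR_gt0.
pose m := eps * s `^ eps * h; have m0 : 0 < m by rewrite !mulr_gt0.
have mt : measurable (tail s) := measurable_volume_tail VP s.
have i1 := has_integral_volume_tail VP eps0 s0.
have i2 := has_integral_ln_volume_tail VP eps0 s0.
have i := has_integralZ mt p^-1 (has_integralD mt
  (has_integralD mt (has_integralZ mt (ln m - 1 - (b + 1) * ln s) i1)
                    (has_integralZ mt (- (b + 1)) i2))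
  (has_integralZ mt m^-1 ih)).
(* The tangent of ln at m, solved for ln f, as a combination of the three
   integrands with known integrals. *)
have le : (\int[mu]_(y in tail s) (V y `^ (- eps - 1) * ln (f y))%:E <=
    \int[mu]_(y in tail s) (p^-1 *
      ((ln m - 1 - (b + 1) * ln s) * V y `^ (- eps - 1) +
      - (b + 1) * (V y `^ (- eps - 1) * (ln (V y) - ln s)) +
      m^-1 * (V y `^ (- eps) * (f y `^ p * V y `^ b))))%:E)%E.
  apply: le_integral_nomeas => y sy; rewrite lee_fin.
  have v0 : 0 < V y by exact: lt_le_trans sy.
  set w := V y `^ (- eps - 1); have w0 : 0 < w by rewrite powR_gt0.
  have -> : V y `^ (- eps) = w * V y.
    by rewrite -{2}(powRr1 (ltW v0)) -powRD ?subrK// (gt_eqF v0) implybT.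
  have F0 : 0 < V y * (f y `^ p * V y `^ b) by rewrite !mulr_gt0 ?powR_gt0.
  have tangent := ln_le_tangent m0 F0.
  have lnF : ln (V y * (f y `^ p * V y `^ b)) =
      ln (V y) + (p * ln (f y) + b * ln (V y)).
    by rewrite !lnM ?posrE ?mulr_gt0 ?powR_gt0// !ln_powR.
  move: tangent; rewrite lnF; set F := f y `^ p * V y `^ b => tangent.
  rewrite [leRHS](_ : _ = w * (p^-1 *
      (ln m - 1 + V y * F / m - (b + 1) * ln (V y)))); last first.
    by field; rewrite !gt_eqF.
  by rewrite ler_pM2l// ler_pdivlMl//; lra.
apply: (le_trans (lee_wpmul2l _ le)).
  by rewrite lee_fin mulr_ge0 ?ltW.
rewrite i.2 -EFinM lee_fin le_eqVlt; apply/orP; left; apply/eqP.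
rewrite powRN /m; field.
by rewrite !gt_eqF.
Qed.

End log_jensen.

(** * The upper bound *)

(** The inequality of the theorem for a general V: the points outside the
    quasi-ball through x are those with V y >= V x. *)
Definition exp_mean_inequality d (T : measurableType d) (R : realType)
    (mu : {measure set T -> \bar R}) (V : T -> R) (p q a b eps C : R) : Prop :=
  forall f : T -> R, measurable_fun setT f -> (forall x, 0 < f x) ->
    ((\int[mu]_x
        ((expeR ((eps * V x `^ eps)%:E *
                 \int[mu]_(y in [set y | (V x <= V y)%R])
                   (V y `^ (- eps - 1) * ln (f y))%:E)) `^ q
         * (V x `^ a)%:E)) `^ q^-1
     <= C%:E * (\int[mu]_x (f x `^ p * V x `^ b)%:E) `^ p^-1)%E.

(** The constant that the two applications of Jensen's inequality produce. *)
Definition jensen_constant (R : realType) (p q b eps : R) : R :=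
  (p / q) `^ q^-1 * eps `^ (p^-1 - q^-1) * expR (- ((b + 1) / (eps * p))).

Lemma jensen_constant_gt0 (R : realType) (p q b eps : R) : 0 < p -> 0 < q ->
  0 < eps -> 0 < jensen_constant p q b eps.
Proof.
by move=> p0 q0 e0; rewrite !mulr_gt0 ?expR_gt0 ?powR_gt0 ?divr_gt0.
Qed.

Section exp_mean_upper_bound.
Context d (T : measurableType d) (R : realType).
Variables (mu : {sigma_finite_measure set T -> \bar R}) (V : T -> R).
Hypothesis VP : volume_function mu V.
Variables (p q a b eps : R).
Hypotheses (p0 : 0 < p) (pq : p <= q) (eps0 : 0 < eps).
Hypothesis balance : p * (a + 1) - q * (b + 1) = 0.
Let r := q / p.
Let q0 : 0 < q. Proof. exact: lt_le_trans pq. Qed.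
Let r1 : 1 <= r. Proof. by rewrite /r ler_pdivlMr// mul1r. Qed.
Let r0 : 0 < r. Proof. exact: lt_le_trans r1. Qed.

Variable f : T -> R.
Hypotheses (mf : measurable_fun setT f) (f0 : forall x, 0 < f x).
Let g y := f y `^ p * V y `^ b.
Variable G : R.
Hypothesis gG : (\int[mu]_y (g y)%:E = G%:E)%E.

Let mg : measurable_fun setT g.
Proof.
apply: measurable_funM; last exact: (measurable_volume_powR VP).
exact: (measurableT_comp (measurable_powR p) mf).
Qed.

Let g0 y : 0 <= g y. Proof. by rewrite mulr_ge0 ?powR_ge0. Qed.

Let tail_integral s : 0 < s ->
  exists2 h, 0 < h & has_integral mu [set y | s <= V y]
                       (fun y => V y `^ (- eps) * g y) h.
Proof.
move=> s0.
have [h _ ih] := has_integral_tail_powR VP mg g0 gG (ltW eps0) s0.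
exists h => //; apply: (has_integral_tail_gt0 VP mg g0 s0 _ ih) => y sy.
by rewrite mulr_gt0 ?powR_gt0// (lt_le_trans s0).
Qed.

Let G0 : 0 < G.
Proof.
have [h h0 [_ ih]] := tail_integral ltr01.
have := integral_tail_powR_le V mg g0 gG (ltW eps0) ltr01.
by rewrite ih lee_fin powR1 mul1r; exact: lt_le_trans.
Qed.

Let K := expR (- (r * (b + 1) / eps)) * eps `^ r.
Let K0 : 0 < K. Proof. by rewrite mulr_gt0 ?expR_gt0 ?powR_gt0. Qed.

(** The two Jensen inequalities combined.  The balance hypothesis makes the
    powers of s = V x that come from the weights add up to s^(eps r - 1). *)
Lemma exp_mean_le_tail_kernel x : 0 < V x ->
  ((expeR ((eps * V x `^ eps)%:E *
           \int[mu]_(y in [set y | (V x <= V y)%R])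
             (V y `^ (- eps - 1) * ln (f y))%:E)) `^ q * (V x `^ a)%:E <=
   (K * G `^ (r - 1))%:E * \int[mu]_y tail_kernel V g (eps * r) (x, y))%E.
Proof.
set s := V x => s0; have [h h0 ih] := tail_integral s0.
set E := expeR _; set c := p^-1 * (ln (eps * s `^ eps * h) - (b + 1) * (ln s + eps^-1)).
have Ec : (E <= (expR c)%:E)%E.
  rewrite -[(expR c)%:E]/(expeR c%:E) lee_expeR.
  exact: (ln_jensen_tail VP f0 p0 eps0 s0 h0 ih).
have Eq : (E `^ q <= (expR c `^ q)%:E)%E.
  rewrite -poweR_EFin; apply: gt0_ler_poweR => //; first exact: ltW.
  - by rewrite in_itv/= expeR_ge0 leey.
  - by rewrite in_itv/= lee_fin expR_ge0 leey.
apply: (le_trans (lee_wpmul2r _ Eq)); first by rewrite lee_fin powR_ge0.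
rewrite tail_kernelE//= -EFinM.
have -> : expR c `^ q * s `^ a = K * s `^ (eps * r - 1) * h `^ r.
  have aE : a = r * (b + 1) - 1.
    by rewrite /r; apply: (mulfI (lt0r_neq0 p0)); move: balance => ?;
       rewrite mulrBr mulrA mulrCA divff ?lt0r_neq0//; lra.
  apply: ln_inj; rewrite ?posrE ?mulr_gt0 ?powR_gt0 ?expR_gt0//.
  rewrite !lnM ?posrE ?mulr_gt0 ?powR_gt0 ?expR_gt0// !ln_powR !expRK.
  rewrite /c !lnM ?posrE ?mulr_gt0 ?powR_gt0// !ln_powR aE /r.
  by field; rewrite !lt0r_neq0.
rewrite EFinM.
have := powR_jensen_tail VP mg g0 gG (ltW eps0) r1 s0 G0 ih.
move=> /(lee_wpmul2l (_ : (0 <= (K * s `^ (eps * r - 1))%:E)%E)) H.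
apply: (le_trans (H _)); first by rewrite lee_fin mulr_ge0 ?powR_ge0 ?ltW.
rewrite !muleA -!EFinM le_eqVlt; apply/orP; left; apply/eqP.
by congr (_%:E * _)%E; ring.
Qed.

Lemma exp_mean_upper_bound :
  ((\int[mu]_x
      ((expeR ((eps * V x `^ eps)%:E *
               \int[mu]_(y in [set y | (V x <= V y)%R])
                 (V y `^ (- eps - 1) * ln (f y))%:E)) `^ q
       * (V x `^ a)%:E)) `^ q^-1 <=
   (jensen_constant p q b eps * G `^ p^-1)%:E)%E.
Proof.
have er0 : 0 < eps * r by rewrite mulr_gt0.
set I := (\int[mu]_x _)%E.
have IK : (I <= (K * G `^ (r - 1) * ((eps * r)^-1 * G))%:E)%E.
  have KG0 : (0 <= (K * G `^ (r - 1))%:E)%E by rewrite lee_fin mulr_ge0 ?powR_ge0 ?ltW.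
  have mk := measurable_tail_kernel VP (eps * r) mg g0.
  apply: (@le_trans _ _ (\int[mu]_x ((K * G `^ (r - 1))%:E *
      \int[mu]_y tail_kernel V g (eps * r) (x, y)))%E).
    apply: (@le_trans _ _ (\int[mu]_(x in [set x | (0 < V x)%R])
      ((K * G `^ (r - 1))%:E * \int[mu]_y tail_kernel V g (eps * r) (x, y)))%E).
      apply: (le_integral_volume_gt0 VP).
      - by move=> x; rewrite mule_ge0 ?poweR_ge0// lee_fin powR_ge0.
      - exact: measurable_funeM.
      - exact: exp_mean_le_tail_kernel.
    apply: ge0_subset_integral_nomeas => // x _.
    by rewrite mule_ge0//; exact: tail_kernel_ge0.
  rewrite ge0_integralZl//; last by move=> x _; exact: (tail_kernel_ge0 _ _ _ g0).
  rewrite [leRHS]EFinM lee_wpmul2l//.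
  exact: (integral_tail_kernel_le VP).
have X0 : 0 < K * G `^ (r - 1) * ((eps * r)^-1 * G).
  by apply: mulr_gt0; apply: mulr_gt0; rewrite ?powR_gt0 ?invr_gt0.
have qV0 : 0 <= q^-1 by rewrite invr_ge0 ltW.
have H := gt0_ler_poweR qV0 _ _ IK.
apply: (le_trans (H _ _)).
- rewrite in_itv/= leey andbT; apply: integral_ge0 => x _.
  by rewrite mule_ge0 ?poweR_ge0// lee_fin powR_ge0.
- by rewrite in_itv/= leey andbT lee_fin ltW.
rewrite poweR_EFin lee_fin le_eqVlt; apply/orP; left; apply/eqP.
apply: ln_inj; rewrite ?posrE.
- exact: powR_gt0.
- by rewrite mulr_gt0 ?powR_gt0 ?jensen_constant_gt0.
rewrite /jensen_constant /K ln_powR.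
rewrite !lnM ?posrE ?mulr_gt0 ?invr_gt0 ?powR_gt0 ?divr_gt0 ?expR_gt0//.
rewrite !ln_powR !expRK lnV ?posrE// lnM ?posrE// /r !ln_div ?posrE//.
by field; rewrite !lt0r_neq0.
Qed.

End exp_mean_upper_bound.

(** If the right-hand integral is infinite there is nothing to prove, because the
    constant is positive. *)
Lemma exp_mean_inequality_jensen_constant d (T : measurableType d) (R : realType)
    (mu : {sigma_finite_measure set T -> \bar R}) (V : T -> R) (p q a b eps : R) :
  volume_function mu V -> 0 < p -> p <= q -> 0 < eps ->
  p * (a + 1) - q * (b + 1) = 0 ->
  exp_mean_inequality mu V p q a b eps (jensen_constant p q b eps).
Proof.
move=> VP p0 pq eps0 bal f mf f0.
have q0 := lt_le_trans p0 pq.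
set RHS := (\int[mu]_x (f x `^ p * V x `^ b)%:E)%E.
have RHS0 : (0 <= RHS)%E.
  by apply: integral_ge0 => x _; rewrite lee_fin mulr_ge0 ?powR_ge0.
have [->|RHSoo] := eqVneq RHS +oo%E.
  rewrite poweRyr ?invr_eq0 ?gt_eqF// gt0_muley ?leey// lte_fin.
  exact: jensen_constant_gt0.
have RHSE : RHS = (fine RHS)%:E by rewrite fineK// ge0_fin_numE// ltey.
rewrite RHSE poweR_EFin -EFinM.
exact: (exp_mean_upper_bound VP p0 pq eps0 bal mf f0 RHSE).
Qed.

(** * Test functions: necessity and the lower bound *)

Section exp_mean_lower_bound.
Context d (T : measurableType d) (R : realType).
Variables (mu : {measure set T -> \bar R}) (V : T -> R).
Hypothesis VP : volume_function mu V.
Variables (p q a b eps : R).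
Hypotheses (p0 : 0 < p) (pq : p <= q) (eps0 : 0 < eps).
Let q0 : 0 < q. Proof. exact: lt_le_trans pq. Qed.

Local Notation tail s := [set y | s <= V y].
Let beta := eps + 1 + b.

(** Solution of f^p V^b = V^(-eps-1) on V >= lam and
    f^p V^b = eta lam^(-eps-1) on 0 < V < lam; the factor lam^(-eps-1) makes the
    family scale with lam.  On the null set V = 0 the value 1 keeps f positive. *)
Definition two_power_test (lam eta : R) (x : T) : R :=
  if lam <= V x then V x `^ (- (beta / p))
  else if 0 < V x then (eta * lam `^ (- eps - 1) * V x `^ (- b)) `^ p^-1
  else 1.

Section test.
Variables lam eta : R.
Hypotheses (lam0 : 0 < lam) (eta0 : 0 < eta).
Local Notation f := (two_power_test lam eta).

Let mlam (c : R) : measurable_fun setT (fun x => c <= V x).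
Proof. by apply: measurable_fun_ler => //; exact: (measurable_volume VP). Qed.

Lemma measurable_two_power_test : measurable_fun setT f.
Proof.
apply: measurable_fun_ifT => //; first exact: (measurable_volume_powR VP).
apply: measurable_fun_ifT => //.
  by apply: measurable_fun_ltr => //; exact: (measurable_volume VP).
apply: (measurableT_comp (measurable_powR p^-1)).
by apply: measurable_funM => //; exact: (measurable_volume_powR VP).
Qed.

Lemma two_power_test_gt0 x : 0 < f x.
Proof.
rewrite /two_power_test; case: ifPn => [lx|_].
  by rewrite powR_gt0// (lt_le_trans lam0).
by case: ifPn => // Vx; rewrite !(powR_gt0, mulr_gt0).
Qed.

Lemma integral_two_power_test_le :
  (\int[mu]_x (f x `^ p * V x `^ b)%:E <=
   (lam `^ (- eps) * (eps^-1 + eta))%:E)%E.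
Proof.
pose c := eta * lam `^ (- eps - 1).
have c0 : 0 < c by rewrite mulr_gt0// powR_gt0.
pose G x := if lam <= V x then V x `^ (- eps - 1) else c.
have mG D : measurable_fun D (EFin \o G).
  apply/measurable_EFinP; apply: measurable_funTS; apply: measurable_fun_ifT => //.
  exact: (measurable_volume_powR VP).
have G0 x : 0 <= G x by rewrite /G; case: ifPn => _; rewrite ?powR_ge0// ltW.
apply: (@le_trans _ _ (\int[mu]_(x in [set x | (0 < V x)%R]) (G x)%:E)%E).
  apply: (le_integral_volume_gt0 VP) => //.
    by move=> x; rewrite lee_fin mulr_ge0 ?powR_ge0.
  move=> x Vx; rewrite lee_fin le_eqVlt /f /G; apply/orP; left; apply/eqP.
  have pN0 : p != 0 by rewrite gt_eqF.
  case: ifPn => [_|_].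
    rewrite -powRrM -powRD ?(gt_eqF Vx) ?implybT//.
    by congr (_ `^ _); rewrite /beta; field.
  rewrite Vx -powRrM mulVf// powRr1 ?mulr_ge0 ?powR_ge0 ?ltW//.
  by rewrite -mulrA -powRD ?(gt_eqF Vx) ?implybT// addNr powRr0 mulr1.
have -> : [set x | 0 < V x] = tail lam `|` V @^-1` `]0, lam[.
  apply/seteqP; split => x /=; rewrite in_itv/=.
    by move=> ->; case: (leP lam (V x)); [left|right].
  by case=> [/(lt_le_trans lam0)|/andP[]].
rewrite ge0_integral_setU//=; last 4 first.
- exact: (measurable_volume_tail VP).
- exact: (measurable_volume_itv VP).
- by move=> x _; rewrite lee_fin.
- apply/disj_setPS => x [/= lx]; rewrite in_itv/= => /andP[_].
  by rewrite ltNge lx.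
rewrite mulrDr EFinD; apply: leeD.
  rewrite mulrC -(integral_volume_tail VP eps0 lam0) le_eqVlt; apply/orP; left.
  by apply/eqP/eq_integral => x; rewrite inE /G => /= ->.
have step : (\int[mu]_(x in V @^-1` `]0%R, lam[) (G x)%:E <=
    \int[mu]_(x in [set x | (V x <= lam)%R]) (cst c%:E) x)%E.
  have step1 : (\int[mu]_(x in V @^-1` `]0%R, lam[) (G x)%:E <=
    \int[mu]_(x in V @^-1` `]0%R, lam[) (cst c%:E) x)%E.
    apply: ge0_le_integral_nomeas => x; first by rewrite lee_fin.
    by rewrite /= in_itv/= lee_fin /G => /andP[_]; case: leP.
  apply: (le_trans step1); apply: ge0_subset_integral_nomeas => x /=.
    by rewrite in_itv/= => /andP[_ /ltW].
  by rewrite lee_fin (ltW c0).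
apply: (le_trans step); rewrite integral_cst; last first.
  rewrite (_ : [set x | _] = V @^-1` `]-oo, lam]).
    exact: (measurable_volume_itv VP).
  by apply/seteqP; split => x; rewrite /= in_itv.
rewrite (volume_le VP (ltW lam0)) -EFinM lee_fin /c le_eqVlt.
apply/orP; left; apply/eqP; rewrite mulrC mulrCA [RHS]mulrC; congr (_ * _).
by rewrite mulrC -{2}(powRr1 (ltW lam0)) -powRD ?subrK// (gt_eqF lam0) implybT.
Qed.

(** The inner integral runs over V >= V x >= lam, where ln f is a multiple of
    ln V. *)
Lemma exp_mean_two_power_test x : lam <= V x ->
  ((expeR ((eps * V x `^ eps)%:E *
           \int[mu]_(y in tail (V x)) (V y `^ (- eps - 1) * ln (f y))%:E)) `^ q
     * (V x `^ a)%:E =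
   (expR (- (q / p * beta / eps)) * V x `^ (a - q / p * beta))%:E)%E.
Proof.
set s := V x => ls; have s0 : 0 < s := lt_le_trans lam0 ls.
have mt : measurable (tail s) := measurable_volume_tail VP s.
have i1 := has_integral_volume_tail VP eps0 s0.
have i2 := has_integral_ln_volume_tail VP eps0 s0.
have [_ ] := has_integralD mt (has_integralZ mt (- (beta / p)) i2)
                            (has_integralZ mt (- (beta / p) * ln s) i1).
rewrite (eq_integral (fun y => (V y `^ (- eps - 1) * ln (f y))%:E)); last first.
  move=> y /[!inE] /= sy; have v0 : 0 < V y := lt_le_trans s0 sy.
  by rewrite /f (le_trans ls sy) ln_powR; congr (_%:E); ring.
move=> ->; rewrite -EFinM; congr (_%:E).
apply: ln_inj; rewrite ?posrE ?mulr_gt0 ?powR_gt0 ?expR_gt0//.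
rewrite !lnM ?posrE ?powR_gt0 ?expR_gt0// !ln_powR !expRK powRN.
by field; rewrite !gt_eqF// powR_gt0.
Qed.

(** C is replaced by its positive part, since its sign is not known and the
    factor of C is only estimated from above. *)
Lemma two_power_test_bound C : exp_mean_inequality mu V p q a b eps C ->
  ((\int[mu]_(x in tail lam)
      (expR (- (q / p * beta / eps)) * V x `^ (a - q / p * beta))%:E) `^ q^-1 <=
   (Num.max C 0 * (lam `^ (- eps) * (eps^-1 + eta)) `^ p^-1)%:E)%E.
Proof.
move=> /(_ f measurable_two_power_test two_power_test_gt0) CP.
have qV0 : 0 <= q^-1 by rewrite invr_ge0 ltW.
have pV0 : 0 <= p^-1 by rewrite invr_ge0 ltW.
have lhs := fun h1 h2 h => le_trans (@gt0_ler_poweR R q^-1 qV0 _ _ h1 h2 h) CP.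
apply: (le_trans (lhs _ _ _ _)).
- rewrite in_itv/= leey andbT; apply: integral_ge0 => x _.
  by rewrite lee_fin mulr_ge0 ?expR_ge0 ?powR_ge0.
- rewrite in_itv/= leey andbT; apply: integral_ge0 => x _.
  by rewrite mule_ge0 ?poweR_ge0// lee_fin powR_ge0.
- rewrite (eq_integral (fun x => ((expeR ((eps * V x `^ eps)%:E *
      \int[mu]_(y in tail (V x)) (V y `^ (- eps - 1) * ln (f y))%:E)) `^ q
     * (V x `^ a)%:E)%E)); last first.
    by move=> x /[!inE] lx; rewrite exp_mean_two_power_test.
  apply: ge0_subset_integral_nomeas => // x _.
  by rewrite mule_ge0 ?poweR_ge0// lee_fin powR_ge0.
have C0 : (0 <= (Num.max C 0)%:E)%E by rewrite lee_fin le_max lexx orbT.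
apply: (@le_trans _ _ ((Num.max C 0)%:E *
    (\int[mu]_x (f x `^ p * V x `^ b)%:E) `^ p^-1)%E).
  by apply: lee_wpmul2r; rewrite ?poweR_ge0// lee_fin le_max lexx.
rewrite EFinM -poweR_EFin; apply: lee_wpmul2l => //.
apply: gt0_ler_poweR => //; last exact: integral_two_power_test_le.
- rewrite in_itv/= leey andbT; apply: integral_ge0 => x _.
  by rewrite lee_fin mulr_ge0 ?powR_ge0.
- by rewrite in_itv/= leey andbT lee_fin mulr_ge0 ?powR_ge0// addr_ge0 ?invr_ge0 ?ltW.
Qed.

End test.

(** The test functions at lam = 1; their right-hand integral decreases to 1 / eps
    as eta tends to 0. *)
Lemma exp_mean_lower_bound C : p * (a + 1) - q * (b + 1) = 0 ->
  exp_mean_inequality mu V p q a b eps C ->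
  (p / q) `^ q^-1 * eps `^ (p^-1 - q^-1)
    * expR (- ((b + 1) / (eps * p)) - p^-1) <= C.
Proof.
move=> bal CP; set A := _ * expR _.
have A0 : 0 < A by rewrite !mulr_gt0 ?powR_gt0 ?divr_gt0 ?expR_gt0.
pose M := Num.max C 0; have M0 : 0 <= M by rewrite le_max lexx orbT.
suff : A <= M by rewrite /M le_max => /orP[//|/(lt_le_trans A0)]; rewrite ltxx.
have step eta : 0 < eta -> A * eps^-1 `^ p^-1 <= M * (eps^-1 + eta) `^ p^-1.
  move=> eta0; have := two_power_test_bound ltr01 eta0 CP.
  have aE : a - q / p * beta = - (eps * (q / p)) - 1.
    rewrite /beta; apply: (mulfI (lt0r_neq0 p0)); move: bal => h.
    have -> : p * (a - q / p * (eps + 1 + b)) = p * a - q * (eps + 1 + b).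
      by field; rewrite lt0r_neq0.
    have -> : p * (- (eps * (q / p)) - 1) = - (eps * q) - p.
      by field; rewrite lt0r_neq0.
    lra.
  have er0 : 0 < eps * (q / p) by rewrite mulr_gt0 ?divr_gt0.
  rewrite powR1 mul1r aE.
  have mt : measurable (tail 1) := measurable_volume_tail VP 1.
  have i1 := has_integral_volume_tail VP er0 ltr01.
  rewrite (has_integralZ mt (expR (- (q / p * beta / eps))) i1).2.
  rewrite poweR_EFin lee_fin powR1 mulr1 => /(le_trans _); apply.
  rewrite le_eqVlt; apply/orP; left; apply/eqP.
  apply: ln_inj; rewrite ?posrE ?mulr_gt0 ?powR_gt0 ?mulr_gt0 ?invr_gt0 ?expR_gt0//.
  rewrite /A ln_powR !lnM ?posrE ?mulr_gt0 ?powR_gt0 ?divr_gt0 ?invr_gt0 ?expR_gt0//.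
  rewrite !ln_powR !expRK !lnV ?posrE ?mulr_gt0 ?divr_gt0 ?invr_gt0//.
  rewrite !lnM ?posrE ?divr_gt0 ?invr_gt0// !lnV ?posrE//.
  by rewrite /beta; field; rewrite !lt0r_neq0.
have epsV0 : 0 < eps^-1 by rewrite invr_gt0.
clearbody A; rewrite -(powR_le_mono p0) ?nnegrE ?(ltW A0)//.
suff : A `^ p * eps^-1 <= M `^ p * eps^-1 by rewrite ler_pM2r.
(* Both sides are raised to the power p, which makes the dependence on eta
   affine; e / (c + 1) is then small enough even if c = 0. *)
apply/ler_addgt0Pr => e e0; pose c := M `^ p; have c0 : 0 <= c := powR_ge0 _ _.
have eta0 : 0 < e / (c + 1) by rewrite divr_gt0// ltr_wpDl.
have {step} := step _ eta0.
rewrite -(powR_le_mono p0) ?nnegrE ?mulr_ge0 ?powR_ge0 ?(ltW A0)//.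
rewrite !powRM ?powR_ge0 ?(ltW A0)//.
rewrite !(powRVK p0) ?(ltW epsV0)//; last by rewrite addr_ge0 ?ltW.
move=> /le_trans; apply; rewrite mulrDr lerD2l -/c mulrCA ler_piMr ?(ltW e0)//.
by rewrite ler_pdivrMr ?mul1r ?lerDl// ltr_wpDl.
Qed.

(** With eta = 1 the test functions give c1 lam^theta <= c2 for every lam > 0,
    where theta vanishes exactly when the balance holds.  The left integral may
    diverge, so it is first cut down to lam < V <= 2 lam, where V^kappa is
    comparable to lam^kappa whatever the sign of kappa. *)
Lemma exp_mean_balance C : exp_mean_inequality mu V p q a b eps C ->
  p * (a + 1) - q * (b + 1) = 0.
Proof.
move=> CP; pose kappa := a - q / p * beta.
pose M := Num.max C 0; have M0 : 0 <= M by rewrite le_max lexx orbT.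
pose c1 := (expR (- (q / p * beta / eps)) * 2 `^ (- `|kappa|)) `^ q^-1.
pose c2 := M * (eps^-1 + 1) `^ p^-1.
pose theta := (kappa + 1) / q + eps / p.
have c10 : 0 < c1 by rewrite powR_gt0 ?mulr_gt0 ?expR_gt0 ?powR_gt0.
have c20 : 0 <= c2 by rewrite mulr_ge0 ?powR_ge0.
have step lam : 0 < lam -> c1 * lam `^ theta <= c2.
  move=> lam0; have := two_power_test_bound lam0 ltr01 CP.
  set E := expR _; set I := (\int[mu]_(x in _) _)%E => IM.
  pose S := V @^-1` `]lam, 2 * lam].
  have kI : ((E * 2 `^ (- `|kappa|) * lam `^ kappa * lam)%:E <= I)%E.
    have mS : mu S = lam%:E.
      rewrite (pushforward_volume VP)//; last first.
        by move=> t /=; rewrite !in_itv/= andbT => /andP[/(lt_trans lam0)].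
      apply: etrans (lebesgue_measure_itv _) _; rewrite /= lte_fin ltr_pMl//.
      by rewrite ltr1n -EFinB; congr (_%:E); ring.
    rewrite EFinM -mS -integral_cst; last exact: (measurable_volume_itv VP).
    apply: (@le_trans _ _
        (\int[mu]_(x in S) (E * V x `^ kappa)%:E)%E); last first.
      apply: ge0_subset_integral_nomeas => x; last first.
        by move=> _; rewrite lee_fin mulr_ge0 ?expR_ge0 ?powR_ge0.
      by rewrite /S/= in_itv/= => /andP[/ltW].
    apply: ge0_le_integral_nomeas => x; rewrite /S/= in_itv/= => /andP[lx xl].
      by rewrite lee_fin !mulr_ge0 ?expR_ge0 ?powR_ge0.
    rewrite lee_fin -mulrA ler_wpM2l ?expR_ge0//.
    pose u := V x / lam; have VE : V x = u * lam by rewrite /u divfK// gt_eqF.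
    have u1 : 1 <= u by rewrite /u ler_pdivlMr// mul1r ltW.
    have u2 : u <= 2 by rewrite /u ler_pdivrMr.
    have u0 : 0 < u := lt_le_trans ltr01 u1.
    rewrite VE powRM ?(ltW u0) ?(ltW lam0)// ler_wpM2r ?powR_ge0//.
    apply: (@le_trans _ _ (u `^ (- `|kappa|))); last first.
      by apply: ler_powR => //; rewrite lerNl -normrN ler_norm.
    rewrite !powRN lef_pV2 ?posrE ?powR_gt0//.
    by rewrite ge0_ler_powR ?nnegrE ?(ltW u0).
  have k0 : 0 <= E * 2 `^ (- `|kappa|) * lam `^ kappa * lam.
    by rewrite !mulr_ge0 ?expR_ge0 ?powR_ge0 ?ltW.
  have qV0 : 0 <= q^-1 by rewrite invr_ge0 ltW.
  have := le_trans (@gt0_ler_poweR R q^-1 qV0 _ _ _ _ kI) IM.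
  rewrite poweR_EFin lee_fin => /(_ _ _) H.
  have {}H : (E * 2 `^ (- `|kappa|) * lam `^ kappa * lam) `^ q^-1 <=
      M * (lam `^ (- eps) * (eps^-1 + 1)) `^ p^-1.
    apply: H; rewrite in_itv/= leey andbT ?lee_fin//.
    by apply: le_trans kI; rewrite lee_fin.
  have lamp : 0 < lam `^ (eps / p) by rewrite powR_gt0.
  rewrite -(ler_pM2r lamp) in H.
  rewrite (_ : c1 * lam `^ theta =
    (E * 2 `^ (- `|kappa|) * lam `^ kappa * lam) `^ q^-1
      * lam `^ (eps / p)); last first.
    rewrite /c1 /theta -(mulrA _ (lam `^ kappa)) [in RHS]powRM;
      rewrite ?mulr_ge0 ?expR_ge0 ?powR_ge0 ?(ltW lam0)//.
    rewrite -[RHS]mulrA; congr (_ * _).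
    have -> : lam `^ kappa * lam = lam `^ (kappa + 1).
      by rewrite powRD ?(gt_eqF lam0) ?implybT// powRr1// ltW.
    by rewrite -powRrM -powRD// (gt_eqF lam0) implybT.
  apply: (le_trans H); rewrite /c2 -mulrA ler_wpM2l//.
  rewrite powRM ?powR_ge0// ?addr_ge0 ?invr_ge0 ?(ltW eps0)//.
  rewrite mulrAC -powRrM mulNr -powRD ?(gt_eqF lam0) ?implybT//.
  by rewrite addNr powRr0 mul1r.
have theta0 : theta = 0.
  apply/eqP/negP => /negP tN0.
  have X0 : 0 < c2 / c1 + 1 by rewrite ltr_wpDl// divr_ge0// ltW.
  (* The lam for which c1 lam^theta = c1 + c2 exceeds c2. *)
  have := step ((c2 / c1 + 1) `^ theta^-1) (powR_gt0 _ X0).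
  rewrite -powRrM mulVf// powRr1 ?(ltW X0)// mulrDr mulr1 mulrCA divff ?gt_eqF//.
  by rewrite mulr1 gerDl leNgt c10.
have : p * q * theta = p * (a + 1) - q * (b + 1).
  by rewrite /theta /kappa /beta; field; rewrite !lt0r_neq0.
by rewrite theta0 mulr0.
Qed.

End exp_mean_lower_bound.

(** * The least constant *)

Section least_constant.
Context d (T : measurableType d) (R : realType).
Variables (mu : {sigma_finite_measure set T -> \bar R}) (V : T -> R).
Hypothesis VP : volume_function mu V.
Variables (p q a b eps : R).
Hypotheses (p0 : 0 < p) (pq : p <= q) (eps0 : 0 < eps).
Local Notation ineq := (exp_mean_inequality mu V p q a b eps).

(** For a fixed f the inequality is a closed condition on C, apart from the value
    +oo of the right-hand integral; there the positive lower bound L keeps the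
    infimum positive. *)
Lemma exp_mean_inequality_inf (L : R) : 0 < L -> (forall C, ineq C -> L <= C) ->
  (exists C, ineq C) -> ineq (inf [set C | ineq C]).
Proof.
move=> L0 LC [C1 CP1]; set S := [set C | ineq C].
have hS : has_inf S by split; [exists C1|exists L].
have infS0 : 0 < inf S by rewrite (lt_le_trans L0)// lb_le_inf//; exists C1.
move=> f mf f0; set X := (_ `^ q^-1)%E; set Y := (_ `^ p^-1)%E.
have SP C : S C -> (X <= C%:E * Y)%E by move=> /(_ f mf f0).
have Y0 : (0 <= Y)%E by exact: poweR_ge0.
have [Yoo|Yoo] := eqVneq Y +oo%E; first by rewrite Yoo gt0_muley ?leey// lte_fin.
have YE : Y = (fine Y)%:E by rewrite fineK// ge0_fin_numE// ltey.
move: SP Y0; rewrite YE; set y := fine Y => SP; rewrite lee_fin => y0.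
have X0 : (0 <= X)%E by exact: poweR_ge0.
have XE : X = (fine X)%:E.
  rewrite fineK// ge0_fin_numE// (le_lt_trans (SP _ CP1))// -EFinM ltry//.
move: SP; rewrite XE; set x := fine X => SP.
rewrite -EFinM lee_fin.
move: y0; rewrite le_eqVlt => /predU1P[y0|y0].
  by have := SP _ CP1; rewrite -EFinM lee_fin -y0 !mulr0.
rewrite -ler_pdivrMr//; apply: lb_le_inf; first by exists C1.
by move=> C /SP; rewrite -EFinM lee_fin ler_pdivrMr.
Qed.

Lemma exp_mean_inequality_least_constant :
  ((exists C, ineq C) <-> p * (a + 1) - q * (b + 1) = 0) /\
  (p * (a + 1) - q * (b + 1) = 0 ->
   exists C : R,
     [/\ ineq C, forall C', ineq C' -> C <= C',
         (p / q) `^ q^-1 * eps `^ (p^-1 - q^-1)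
           * expR (- ((b + 1) / (eps * p)) - p^-1) <= C
       & C <= jensen_constant p q b eps]).
Proof.
have upper := exp_mean_inequality_jensen_constant VP p0 pq eps0.
split.
  split => [[C]|bal]; first exact: (exp_mean_balance VP p0 pq eps0).
  by exists (jensen_constant p q b eps); exact: upper.
move=> bal.
have lower C := @exp_mean_lower_bound _ _ _ _ _ VP _ _ _ b _ p0 pq eps0 C bal.
have q0 := lt_le_trans p0 pq.
set L := _ * expR _ in lower *.
have L0 : 0 < L by rewrite !mulr_gt0 ?powR_gt0 ?divr_gt0 ?expR_gt0.
have ex : exists C, ineq C by exists (jensen_constant p q b eps); exact: upper.
exists (inf [set C | ineq C]); split.
- exact: exp_mean_inequality_inf L0 lower ex.
- by move=> C' C'P; apply: ge_inf => //; exists L.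
- by apply: lb_le_inf => //.
- by apply: ge_inf; [exists L|exact: upper].
Qed.

End least_constant.

(** * Lebesgue measure on row vectors *)

Section lebesgue_rowvectors.
Context (R : realType).
Implicit Types n : nat.

Lemma measurable_rV_forall n (P : 'I_n -> set R) : (forall i, measurable (P i)) ->
  measurable [set w : rV_borel R n | forall i, P i (rV_coord i w)].
Proof.
move=> mP.
rewrite (_ : [set w | _] = ~` \bigcup_i ~` (rV_coord i @^-1` P i)); last first.
  rewrite setC_bigcup; apply/seteqP; split => w /= h i.
    by move=> _; apply; exact: h.
  by apply: contrapT; exact: h i Logic.I.
apply: measurableC; apply: countable_bigcupT_measurable => // i.
apply: measurableC; rewrite -[_ @^-1` _]setTI.
by apply: measurable_rV_coord => //; exact: mP.
Qed.

(** An open set is the union of the boxes with rational centre and radius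
    1 / (k + 1) that it contains, and there are countably many of them. *)
Lemma open_rV_borel_measurable n (U : set 'rV[R]_n) : open U ->
  measurable (U : set (rV_borel R n)).
Proof.
move=> oU.
pose box (z : 'rV[rat]_n * nat) : set (rV_borel R n) :=
  [set v | forall i, `|ratr (z.1 ord0 i) - rV_coord i v| < z.2.+1%:R^-1].
have mbox z : measurable (box z).
  pose P i : set R := [set t | `|ratr (z.1 ord0 i) - t| < z.2.+1%:R^-1].
  apply: (@measurable_rV_forall _ P) => i; apply: open_measurable.
  rewrite (_ : P i = (fun t => `|ratr (z.1 ord0 i) - t|) @^-1`
    [set t | t < z.2.+1%:R^-1])//.
  apply: open_comp => [t _|]; last exact: open_lt.
  by apply: cvg_norm; apply: cvgB; [exact: cvg_cst|exact: cvg_id].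
pose I := [set z | box z `<=` U].
rewrite (_ : U = \bigcup_z (if z \in I then box z else set0)); last first.
  apply/seteqP; split => [v Uv|v [z _]]; last first.
    by case: ifPn => // /set_mem h; exact: h.
  have /nbhs_ballP[e /= e0 eU] : nbhs v U by exact: open_nbhs_nbhs.
  have [k ke] : exists k : nat, k.+1%:R^-1 < e / 2.
    exists (Num.truncn (e / 2)^-1).
    by rewrite invf_plt ?posrE ?divr_gt0// truncnS_gt.
  have kV0 : 0 < k.+1%:R^-1 :> R by rewrite invr_gt0.
  have [z vz] : exists z : 'rV[rat]_n,
      forall i, `|ratr (z ord0 i) - v ord0 i| < k.+1%:R^-1.
    have /choice[z vz] : forall i : 'I_n, exists c : rat,
        `|ratr c - v ord0 i| < k.+1%:R^-1.
      move=> i; have /rat_in_itvoo[c] : v ord0 i - k.+1%:R^-1 < v ord0 i + k.+1%:R^-1.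
        by rewrite ltrBlDr -addrA ltrDl addr_gt0.
      by rewrite in_itv/= => cv; exists c; rewrite ltr_distl.
    by exists (\row_i z i) => i; rewrite mxE.
  exists (z, k) => //; rewrite ifT//; apply/mem_set => w /= zw; apply: eU.
  split => // i j; rewrite (ord1 i) /ball/=.
  rewrite [ltRHS](splitr e) (le_lt_trans (ler_distD (ratr (z ord0 j)) _ _))//.
  apply: ltrD; last exact: lt_trans (zw j) ke.
  by rewrite distrC; exact: lt_trans (vz j) ke.
by apply: countable_bigcupT_measurable => // z; case: ifPn.
Qed.

Lemma lebesgue_rVE n (A : set (rV_borel R n)) : measurable A ->
  measurable (A : set (rV_lebesgue R n)) /\ lebesgue_rV A = lebesgue_rV_borel n A.
Proof.
move=> mA; split; last exact: measurable_mu_extE.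
by apply: sub_caratheodory; exact: sub_sigma_algebra.
Qed.

(** c times the image of Lebesgue measure under x |-> c x has the right value on
    intervals, hence is Lebesgue measure. *)
Lemma ge0_integral_scale (F : R -> \bar R) (c : R) : 0 < c ->
  measurable_fun setT F -> (forall x, (0 <= F x)%E) ->
  (\int[lebesgue_measure]_x F (c * x)%R =
   c^-1%:E * \int[lebesgue_measure]_x F x)%E.
Proof.
move=> c0 mF F0.
have mc : measurable_fun setT ( *%R c : measurableTypeR R -> measurableTypeR R).
  by apply: measurable_funM.
pose push : {measure set (measurableTypeR R) -> \bar R} :=
  measure_function_pushforward__canonical__measure_function_Measure
    (@lebesgue_measure R) mc.
have cn0 : 0 <= c := ltW c0.
pose m : {measure set (measurableTypeR R) -> \bar R} := mscale (NngNum cn0) push.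
have lebE A : measurable A -> lebesgue_measure A = m A.
  apply: lebesgue_measure_unique => _ [[x y] _ <-] /=.
  have -> : m `]x, y]%classic =
      (c%:E * lebesgue_measure `](c^-1 * x)%R, (c^-1 * y)%R])%E.
    rewrite -[LHS]/(c%:E * lebesgue_measure ( *%R c @^-1` `]x, y]))%E.
    congr (_ * lebesgue_measure _)%E; apply/seteqP; split => t /=;
      by rewrite !in_itv/= ltr_pdivrMl// ler_pdivlMl.
  apply: etrans (lebesgue_measure_itv _) _.
  rewrite [X in _ = (_ * X)%E](_ : _ = (if (c^-1 * x)%:E < (c^-1 * y)%:E
    then (c^-1 * y)%:E - (c^-1 * x)%:E else 0)%E); last exact: lebesgue_measure_itv.
  rewrite /= !lte_fin ltr_pM2l ?invr_gt0//; case: ifPn => _; last by rewrite mule0.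
  by rewrite -!EFinB -EFinM -mulrBr mulVKf// gt_eqF.
have -> : (\int[lebesgue_measure]_x F (c * x)%R = \int[push]_x F x)%E.
  by apply/esym; apply: ge0_integral_pushforward.
have -> : (\int[lebesgue_measure]_x F x = \int[m]_x F x)%E.
  by apply: eq_measure_integral => A mA _; exact: lebE.
rewrite ge0_integral_mscale//= muleA -EFinM mulVf ?gt_eqF//.
by rewrite mul1e.
Qed.

Lemma rV_coord_cons0 n (x : R) (w : rV_borel R n) :
  rV_coord ord0 (rV_cons (x, w)) = x.
Proof. by have [] := rV_consK (x, w). Qed.

Lemma rV_coord_consS n (x : R) (w : rV_borel R n) i :
  rV_coord (lift ord0 i) (rV_cons (x, w)) = rV_coord i w.
Proof.
have [_ /rowP/(_ i)] := rV_consK (x, w).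
by rewrite mxE (_ : rshift 1 i = lift ord0 i)//; exact/val_inj.
Qed.

Lemma dilation_cons n (v : 'I_n.+1 -> R) r (x : R) (w : rV_borel R n) :
  dilation v r (rV_cons (x, w)) =
  rV_cons (r `^ v ord0 * x, dilation (fun i => v (lift ord0 i)) r w).
Proof.
apply/rowP => i; rewrite mxE; have [j ->|->] := unliftP ord0 i.
  have := rV_coord_consS x w j; rewrite /rV_coord => ->.
  have := rV_coord_consS (r `^ v ord0 * x)
    (dilation (fun i => v (lift ord0 i)) r w) j.
  by rewrite /rV_coord => ->; rewrite mxE.
have := rV_coord_cons0 x w; rewrite /rV_coord => ->.
have := rV_coord_cons0 (r `^ v ord0 * x) (dilation (fun i => v (lift ord0 i)) r w).
by rewrite /rV_coord => ->.
Qed.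

(** Induction on n along the slicing that defines the measure: the slices are
    rescaled by the induction hypothesis, the first coordinate by
    [ge0_integral_scale]. *)
Lemma lebesgue_rV_borel_dilation n (v : 'I_n -> R) r (A : set (rV_borel R n)) :
  0 < r -> measurable A ->
  lebesgue_rV_borel n [set w | A (dilation v r w)] =
  ((r `^ (\sum_i v i))^-1%:E * lebesgue_rV_borel n A)%E.
Proof.
move=> r0; elim: n v A => [|n IH] v A mA.
  rewrite big_ord0 powRr0 invr1 mul1e /=.
  rewrite (_ : [set w | _] = A)//; apply/funext => w /=.
  by rewrite (thinmx0 (dilation _ _ _)) (thinmx0 w).
have msec x : measurable [set w : rV_borel R n | A (rV_cons (x, w))].
  have mx : measurable_fun setT (fun w : rV_borel R n => rV_cons (x, w)).
    apply: (measurableT_comp (@measurable_rV_cons R n)).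
    by apply: measurable_fun_pair.
  by rewrite -[X in measurable X]setTI; exact: mx.
have r1 : 0 < r `^ v ord0 by rewrite powR_gt0.
rewrite /=.
under eq_integral => x _.
  rewrite (_ : [set w | _] = [set w | [set u : rV_borel R n |
     A (rV_cons (r `^ v ord0 * x, u))] (dilation (fun i => v (lift ord0 i)) r w)]).
    rewrite IH//; over.
  by apply/seteqP; split => w /=; rewrite dilation_cons.
pose F x := lebesgue_rV_borel n [set w : rV_borel R n | A (rV_cons (x, w))].
have mF : measurable_fun setT F.
  pose B := @rV_cons R n @^-1` A.
  have mB : measurable B.
    by rewrite -[B]setTI; exact: measurable_rV_cons.
  have := measurable_fun_xsection (@lebesgue_rV_borel R n) mB.
  congr (measurable_fun _ _); apply/funext => x; congr (lebesgue_rV_borel n _).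
  by apply/seteqP; split => w; rewrite /xsection/= ?inE.
rewrite ge0_integralZl//; last 2 first.
- apply: (measurableT_comp mF); exact: measurable_funM.
- by rewrite lee_fin invr_ge0 powR_ge0.
rewrite (@ge0_integral_scale F _ r1 mF)// muleA -EFinM -invfM.
by rewrite big_ord_recl mulrC powRD// (gt_eqF r0) implybT.
Qed.

Lemma measurable_rV_borel_box n :
  measurable [set w : rV_borel R n | forall i, `|rV_coord i w| <= 1].
Proof.
rewrite (_ : [set w | _] =
    [set w | forall i, (`[(-1), 1]%classic : set R) (rV_coord i w)]).
  apply: (@measurable_rV_forall _ (fun=> `[(-1), 1]%classic)) => i.
  exact: measurable_itv.
by apply/seteqP; split => w /= h i; have := h i; rewrite /= in_itv/= ler_norml.
Qed.

Lemma lebesgue_rV_borel_box_lty n :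
  (lebesgue_rV_borel n [set w : rV_borel R n | forall i, `|rV_coord i w| <= 1]%R
    < +oo)%E.
Proof.
elim: n => [|n IH]; first by rewrite /= diracE ltry.
set B := [set w | _] in IH.
rewrite /= (_ : (fun x => _) = (fun=> lebesgue_rV_borel n B) \_ `[(-1)%R, 1%R]).
  rewrite -integral_mkcond integral_cst//.
  rewrite lte_mul_pinfty ?ge0_fin_numE//.
  by rewrite [X in (X < _)%E]lebesgue_measure_itv/=; case: ifPn => _; rewrite ltry.
apply/funext => x; rewrite patchE.
have boxE w : (forall i, `|rV_coord i (rV_cons (x, w))| <= 1) <->
    `|x| <= 1 /\ forall i, `|rV_coord i w| <= 1.
  split=> [h|[x1 h] i].
    split=> [|i]; first by have := h ord0; rewrite rV_coord_cons0.
    by have := h (lift ord0 i); rewrite rV_coord_consS.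
  have [j ->|->] := unliftP ord0 i; first by rewrite rV_coord_consS.
  by rewrite rV_coord_cons0.
rewrite mem_setE in_itv/= -ler_norml; case: ifPn => x1.
  congr (lebesgue_rV_borel n _); apply/seteqP; split => w /=.
    by rewrite boxE => -[].
  by rewrite boxE => h; split.
rewrite (_ : [set w | _] = set0) ?measure0//.
by apply/seteqP; split => // w /=; rewrite boxE (negbTE x1) => -[].
Qed.

Lemma lebesgue_rV_borelT_gt0 n : (0 < lebesgue_rV_borel n [set: rV_borel R n])%E.
Proof.
elim: n => [|n IH]; first by rewrite /= diracT lte_fin.
rewrite /= (_ : (fun x => _) = cst (lebesgue_rV_borel n [set: rV_borel R n])).
  rewrite integral_cst// [X in (_ * X)%E](_ : _ = +oo%E) ?gt0_muley ?ltry//.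
  by rewrite -set_itvNyy; exact: lebesgue_measure_itv.
by apply/funext.
Qed.

End lebesgue_rowvectors.

(** * The volume of quasi-balls *)

Section quasi_norm_volume.
Context (R : realType) (N : nat) (hN : (0 < N)%N) (G : homogeneous_group R N).
Variables (nrm : 'rV[R]_N -> R) (hnrm : quasi_norm G nrm).
Local Notation v := (hg_weight G).
Local Notation Q := (homogeneous_dimension G).
Local Notation ball r := ([set y | nrm y < r] : set (rV_borel R N)).
Local Notation kappa := (lebesgue_rV_borel N (ball 1)).

Lemma homogeneous_dimension_gt0 : 0 < Q.
Proof.
rewrite /homogeneous_dimension (bigD1 (Ordinal hN))//= ltr_pwDl ?hg_weight_gt0//.
by apply: sumr_ge0 => i _; exact/ltW/hg_weight_gt0.
Qed.

(** With m the minimum of the quasi-norm on the unit sphere of the max norm: a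
    point x outside the unit box is brought to that sphere by the dilation with
    ratio 1 / w k < 1, where w j = |x_j|^(1 / v_j) and w k is the largest of
    them; hence nrm x >= m (w k) > m. *)
Lemma quasi_ball_sub_box : exists2 m, 0 < m &
  forall x, nrm x < m -> forall i, `|x ord0 i| <= 1.
Proof.
pose i0 := Ordinal hN.
pose S := [set x : 'rV[R]_N | `|x| = 1].
have cS : compact S.
  apply: bounded_closed_compact.
    by exists 1; split => // M M1 x /= ->; exact: ltW.
  rewrite (_ : S = (fun x : 'rV[R]_N => `|x|) @^-1` [set 1])//.
  by apply: closed_comp => [x _|]; [exact: norm_continuous|exact: closed_eq].
have normE (x : 'rV[R]_N) : `|x| = \big[Num.max/0]_ij `|x ij.1 ij.2|.
  exact: mx_normrE.
have normle (x : 'rV[R]_N) c : 0 <= c -> (`|x| <= c) <-> (forall i, `|x ord0 i| <= c).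
  move=> c0; rewrite normE; split.
    by move=> /bigmax_leP[_ h] i; exact: (h (ord0, i)).
  by move=> h; apply/bigmax_leP; split => // -[i j] _ /=; rewrite (ord1 i).
have S0 : S !=set0.
  exists (const_mx 1); rewrite /S/=; apply/eqP; rewrite eq_le; apply/andP; split.
    by apply/(normle _ _ ler01) => i; rewrite mxE normr1.
  rewrite normE; apply/bigmax_geP; right.
  by exists (ord0, i0) => //=; rewrite mxE normr1.
have [c cS' cmin] := compact_EVT_min S0 cS (continuous_subspaceT (qn_continuous hnrm)).
move/set_mem : cS' => c1.
have nc0 : 0 < nrm c.
  rewrite lt_neqAle (qn_ge0 hnrm) andbT; apply/eqP => nc.
  have /(qn_eq0 hnrm) c0 : nrm c = 0 by [].
  by move: c1; rewrite /S/= c0 normr0 => /esym/eqP; rewrite oner_eq0.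
exists (nrm c) => // x xc i; rewrite leNgt; apply/negP => xi.
pose w j := `|x ord0 j| `^ (v j)^-1.
pose k := [arg max_(j > i) w j]%O.
have wk j : w j <= w k by rewrite /k; case: arg_maxP => // l _; exact.
have one c' : 1 `^ c' = 1 :> R by rewrite powR1.
have vN0 j : v j != 0 by rewrite gt_eqF// hg_weight_gt0.
have wi1 : 1 < w i.
  rewrite -[ltLHS](one (v i)^-1).
  by rewrite gt0_ltr_powR ?invr_gt0 ?hg_weight_gt0// ?nnegrE.
have wk1 : 1 < w k := lt_le_trans wi1 (wk i).
have wk0 : 0 < w k := lt_trans ltr01 wk1.
have wE j : w j `^ v j = `|x ord0 j| by rewrite -powRrM mulVf// powRr1.
pose y := dilation v (w k)^-1 x.
have yE j : `|y ord0 j| = (w k)^-1 `^ v j * w j `^ v j.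
  by rewrite mxE normrM wE ger0_norm ?powR_ge0.
have wV0 : 0 <= (w k)^-1 by rewrite invr_ge0 ltW.
have w0 j : 0 <= w j by exact: powR_ge0.
have yS : S y.
  rewrite /S/=; apply/eqP; rewrite eq_le; apply/andP; split.
    apply/(normle _ _ ler01) => j; rewrite yE -powRM// -[leRHS](one (v j)).
    rewrite ge0_ler_powR ?nnegrE ?mulr_ge0// ?(ltW (hg_weight_gt0 _ _))//.
    by rewrite mulrC ler_pdivrMr// mul1r.
  rewrite normE; apply/bigmax_geP; right; exists (ord0, k) => //=.
  by rewrite yE -powRM// mulVf ?gt_eqF// powR1.
have := cmin y (mem_set yS).
rewrite (qn_dilation hnrm) ?invr_gt0// leNgt => /negP; apply.
rewrite mulrC ltr_pdivrMr// (lt_trans xc)// ltr_pMr//.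
Qed.

Lemma measurable_quasi_ball r : measurable (ball r).
Proof.
apply: open_rV_borel_measurable.
rewrite (_ : [set y | _] = nrm @^-1` [set t | t < r])//.
by apply: open_comp => [x _|]; [exact: qn_continuous hnrm _|exact: open_lt].
Qed.

Lemma lebesgue_quasi_ball r : 0 < r ->
  lebesgue_rV_borel N (ball r) = ((r `^ Q)%:E * kappa)%E.
Proof.
move=> r0; have rV0 : 0 < r^-1 by rewrite invr_gt0.
have -> : ball r = [set w | ball 1 (dilation v r^-1 w)].
  apply/seteqP; split => y /=; rewrite (qn_dilation hnrm)// mulrC ltr_pdivrMr// mul1r//.
rewrite lebesgue_rV_borel_dilation//; last exact: measurable_quasi_ball.
by rewrite -powRN -powR_inv1 ?(ltW r0)// -powRrM mulN1r opprK.
Qed.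

(** Finite because a small quasi-ball lies in the unit box; positive because
    otherwise all quasi-balls, and with them the whole space, would be null. *)
Lemma lebesgue_unit_quasi_ball : exists2 k, 0 < k & kappa = k%:E.
Proof.
have kfin : (kappa < +oo)%E.
  have [m m0 mbox] := quasi_ball_sub_box.
  have : (lebesgue_rV_borel N (ball m) < +oo)%E.
    apply: le_lt_trans (lebesgue_rV_borel_box_lty R N).
    apply: le_measure; rewrite ?inE.
    - exact: measurable_quasi_ball.
    - exact: measurable_rV_borel_box.
    - by move=> x /= xm i; exact: mbox.
  rewrite lebesgue_quasi_ball//.
  have [->|h] := eqVneq kappa +oo%E; last by move=> _; rewrite ltey.
  by rewrite gt0_muley ?lte_fin ?powR_gt0.
have kE : kappa = (fine kappa)%:E by rewrite fineK// ge0_fin_numE.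
exists (fine kappa) => //; rewrite lt_neqAle fine_ge0// andbT; apply/eqP => k0.
have ball0 n : (@lebesgue_rV_borel R N).-negligible (ball n.+1%:R).
  apply/negligibleP; first exact: measurable_quasi_ball.
  by apply: etrans (lebesgue_quasi_ball _) _; rewrite// kE -k0 mule0.
have := negligible_bigcup ball0.
rewrite (_ : \bigcup_n _ = setT); last first.
  apply/seteqP; split => // x _; exists (Num.truncn (nrm x)) => //=.
  exact: truncnS_gt.
move=> /(negligibleP _ measurableT) T0.
by have := lebesgue_rV_borelT_gt0 R N; rewrite [X in (_ < X)%E]T0 ltxx.
Qed.

Lemma quasi_ball_volumeE : exists2 k, 0 < k &
  (forall r, 0 < r -> lebesgue_rV (qball nrm r) = (k * r `^ Q)%:E) /\
  forall x, qball_volume nrm x = k * nrm x `^ Q.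
Proof.
have [k k0 kE] := lebesgue_unit_quasi_ball; exists k => //.
have volE r : 0 < r -> lebesgue_rV (qball nrm r) = (k * r `^ Q)%:E.
  move=> r0; rewrite (lebesgue_rVE (measurable_quasi_ball r)).2.
  by rewrite lebesgue_quasi_ball// kE -EFinM mulrC.
split => // x; rewrite /qball_volume.
have := qn_ge0 hnrm x; rewrite le_eqVlt => /predU1P[<-|x0]; last by rewrite volE.
rewrite (_ : qball nrm 0 = set0) ?measure0 ?powR0 ?mulr0//.
  by rewrite gt_eqF// homogeneous_dimension_gt0.
by apply/seteqP; split => // y; rewrite /qball/= ltNge (qn_ge0 hnrm).
Qed.

Lemma volume_function_qball_volume :
  volume_function (@lebesgue_rV R N) (qball_volume nrm : rV_lebesgue R N -> R).
Proof.
have [k k0 [ballE VE]] := quasi_ball_volumeE.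
have Q0 := homogeneous_dimension_gt0.
have Vlt t : 0 < t -> [set x : rV_lebesgue R N | qball_volume nrm x < t] =
    qball nrm ((t / k) `^ Q^-1).
  move=> t0; have tk0 : 0 < t / k by rewrite divr_gt0.
  have E x : (k * nrm x `^ Q < t) = (nrm x < (t / k) `^ Q^-1).
    rewrite [k * _]mulrC -(ltr_pdivlMr _ _ k0) -{1}(powRVK Q0 (ltW tk0)).
    by rewrite (leW_mono_in (powR_le_mono Q0)) ?nnegrE ?powR_ge0 ?(qn_ge0 hnrm).
  by apply/seteqP; split => x; rewrite /qball/= VE E.
split.
- apply: (measurability _ (RGenInftyO.measurableE R)) => _ [_ [t ->] <-].
  rewrite setTI; have [t0|t0] := leP t 0.
    rewrite (_ : _ @^-1` _ = set0)//; apply/seteqP; split => // x /=.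
    by rewrite in_itv/= VE ltNge (le_trans t0)// mulr_ge0 ?powR_ge0 ?(ltW k0).
  rewrite (_ : _ @^-1` _ = qball nrm ((t / k) `^ Q^-1)).
    exact: (lebesgue_rVE (measurable_quasi_ball _)).1.
  by rewrite -Vlt//; apply/seteqP; split => x /=; rewrite in_itv.
- by move=> x; rewrite VE mulr_ge0 ?powR_ge0 ?ltW.
- move=> t t0; rewrite Vlt// ballE ?powR_gt0 ?divr_gt0//.
  by rewrite powRVK ?divr_ge0 ?ltW// mulrC divfK// gt_eqF.
Qed.

Lemma exp_inequalityE (p q a b eps C : R) :
  exp_inequality nrm p q a b eps C =
  exp_mean_inequality (@lebesgue_rV R N) (qball_volume nrm) p q a b eps C.
Proof.
have [k k0 [_ VE]] := quasi_ball_volumeE.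
have ballE x : ~` qball nrm (nrm x) =
    [set y : rV_lebesgue R N | qball_volume nrm x <= qball_volume nrm y].
  apply/seteqP; split => y; rewrite /qball/= !VE ler_pM2l// powR_le_mono
    ?nnegrE ?(qn_ge0 hnrm) ?homogeneous_dimension_gt0// leNgt.
    by move/negP.
  by move=> /negP.
(* Both inequalities are P at a family of domains of integration, so equality
   of the two families suffices. *)
pose P (D : 'rV[R]_N -> set (rV_lebesgue R N)) :=
  forall f : rV_lebesgue R N -> R, measurable_fun setT f -> (forall x, 0 < f x) ->
    ((\int[@lebesgue_rV R N]_x
        ((expeR ((eps * qball_volume nrm x `^ eps)%:E *
                 \int[@lebesgue_rV R N]_(y in D x)
                   (qball_volume nrm y `^ (- eps - 1) * ln (f y))%:E)) `^ q
         * (qball_volume nrm x `^ a)%:E)) `^ q^-1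
     <= C%:E * (\int[@lebesgue_rV R N]_x
                  (f x `^ p * qball_volume nrm x `^ b)%:E) `^ p^-1)%E.
pose D1 (x : 'rV[R]_N) : set (rV_lebesgue R N) := ~` qball nrm (nrm x).
pose D2 (x : 'rV[R]_N) : set (rV_lebesgue R N) :=
  [set y | qball_volume nrm x <= qball_volume nrm y].
have D12 : D1 = D2 by apply/funext => x; exact: ballE.
have E1 : exp_inequality nrm p q a b eps C = P D1 by reflexivity.
have E2 : exp_mean_inequality (@lebesgue_rV R N) (qball_volume nrm)
    p q a b eps C = P D2.
  by reflexivity.
by clearbody P D1 D2; rewrite E1 E2 D12.
Qed.

End quasi_norm_volume.

(** * The inequality on a homogeneous group *)

Theorem theorem3p4 (R : realType) (N : nat) (hN : (0 < N)%N)
  (G : homogeneous_group R N) (Q : R) (hQ : Q = homogeneous_dimension G)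
  (nrm : 'rV[R]_N -> R) (hnrm : quasi_norm G nrm)
  (p q a b eps : R) (hp : 0 < p) (hpq : p <= q) (heps : 0 < eps) :
  ((exists C : R, exp_inequality nrm p q a b eps C) <->
   p * (a + 1) - q * (b + 1) = 0) /\
  (p * (a + 1) - q * (b + 1) = 0 ->
   exists C : R,
     [/\ exp_inequality nrm p q a b eps C,
         forall C' : R, exp_inequality nrm p q a b eps C' -> C <= C',
         (p / q) `^ q^-1 * eps `^ (p^-1 - q^-1)
           * expR (- ((b + 1) / (eps * p)) - p^-1) <= C
       & C <= (p / q) `^ q^-1 * eps `^ (p^-1 - q^-1)
           * expR (- ((b + 1) / (eps * p)))]).
Proof.
have VP := volume_function_qball_volume hN hnrm.
have [bal least] := exp_mean_inequality_least_constant VP a b hp hpq heps.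
have E C := exp_inequalityE hN hnrm p q a b eps C.
split.
  apply: iff_trans bal; split=> -[C CP]; exists C; first by rewrite -E.
  by rewrite E.
move=> /least[C [CP Cmin Clow Cup]]; exists C; split.
- by rewrite E.
- by move=> C'; rewrite E; exact: Cmin.
- exact: Clow.
- exact: Cup.
Qed.
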